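(* Let $N\geq 2$ and let $p(\theta)=a_0+\sum_{k=1}^{N}(a_k\cos k\theta+b_k\sin k\theta)$ be a real trigonometric polynomial with $a_N\neq 0$ or $b_N\neq 0$. Let $\mathcal{C}\subset\mathbb{R}^2$ be the curve parametrized by $\theta\in[-\pi,\pi]\mapsto \big(p(\theta)\cos\theta-p'(\theta)\sin\theta,\ p(\theta)\sin\theta+p'(\theta)\cos\theta\big)$, and let $f\in\mathbb{R}[x,y]$ be its defining polynomial. (i) If $a_{2k}\neq 0$ for some integer $k$ with $0\le 2k\le N$, or $b_{2k}\neq0$ for some integer $k$ with $2\le 2k\le N$, then $f$ has total degree $2N+2$. (ii) If $a_{2k}=0$ and $b_{2k}=0$ for all integers $k$ with $0\leq 2k\leq N$ (with $b_0:=0$), then $f$ has total degree $N+1$.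
   Context: The defining polynomial of the (irreducible, real algebraic) curve $\mathcal{C}$ is the irreducible polynomial $f\in\mathbb{R}[x,y]$, unique up to multiplication by a nonzero constant, whose zero set is the Zariski closure of $\mathcal{C}$. *)

(* Defs.v *)
From Stdlib Require Import Reals.
From Coquelicot Require Import Coquelicot.
From HB Require Import structures.
From mathcomp Require Import all_boot all_order all_algebra.
From mathcomp Require Import Rstruct.
From mathcomp Require Import mpoly.

Set Implicit Arguments.
Unset Strict Implicit.
Unset Printing Implicit Defensive.

Import GRing.Theory.

Notation poly2 := {mpoly R[2]}.

Definition eval2 (f : poly2) (x y : R) : R :=
  f.@[fun i : 'I_2 => if val i == 0%N then x else y].

(* Total degree (for f <> 0): msize f = 1 + total degree. *)
Definition total_degree (f : poly2) : nat := (msize f).-1.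

(* Irreducibility in R[x,y]: nonconstant, and any factorization has a
   constant (= unit, since f <> 0) factor. *)
Definition irreducible2 (f : poly2) : Prop :=
  (1 < msize f)%N /\
  forall g h : poly2, f = (g * h)%R -> (msize g <= 1)%N \/ (msize h <= 1)%N.

Definition zero_set (f : poly2) : R * R -> Prop :=
  fun P => eval2 f P.1 P.2 = 0%R.

Definition zariski_closure (S : R * R -> Prop) : R * R -> Prop :=
  fun P => forall g : poly2, (forall Q, S Q -> eval2 g Q.1 Q.2 = 0%R) ->
                             eval2 g P.1 P.2 = 0%R.

Definition defining_poly (S : R * R -> Prop) (f : poly2) : Prop :=
  irreducible2 f /\ forall P, zero_set f P <-> zariski_closure S P.

Definition trig_poly (a b : nat -> R) (N : nat) (t : R) : R :=
  (a 0%N + \sum_(1 <= k < N.+1) (a k * cos (INR k * t) + b k * sin (INR k * t)))%R.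

Definition trig_curve (a b : nat -> R) (N : nat) : R * R -> Prop :=
  fun P => exists t : R, (- PI <= t <= PI)%R /\
    P = ((trig_poly a b N t * cos t - Derive (trig_poly a b N) t * sin t)%R,
         (trig_poly a b N t * sin t + Derive (trig_poly a b N) t * cos t)%R).

(* Main.v *)
(** Parametrize the curve by [s = tan (t / 2)], or by [s = tan t] when [p] has only odd
    frequencies: then [x = A / D] and [y = B / D] with [D] a power of [1 + s^2], [A] and
    [B] of degree at most [n = deg D] ([2N + 2], resp. [N + 1]) and [A] prime to [D].
    By Gauss's lemma the irreducible [f] divides every polynomial vanishing on the curve,
    so the degree [d] of [f] can be read off the growth of the space of restrictions to
    the curve of polynomials of degree at most [e], whose dimension is [d e + O(1)].
    These restrictions are polynomials in [s] of degree at most [n e] over [D^e], hence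
    [d <= n].  If moreover [s] is a rational function of [(x, y)], the functions
    [x^j s^i] with [i < n] show that the dimension is at least [n e + O(1)], because
    [D]-adic expansions in powers of [A / D] are unique; hence [n <= d].

    Rationality of [s]: since [(x', y') = (p + p'') (- sin t, cos t)], the gradient of [f]
    on the curve is [r (cos t, sin t)] for some function [r].  This gives [tan t] at once.
    In general [r^2] and, as [x cos t + y sin t = p], also [r p] are polynomial in
    [(x, y)].  With [p = p_even + p_odd], the products of [p_even] by even powers of [r]
    and of [p_odd] by odd powers of [r] are polynomial for large exponents, so [r] is a
    rational function as soon as [p_even] is nonzero, and then so is [tan (t / 2)]. *)

Require Import Defs.
From Stdlib Require Import Reals Classical.
From Coquelicot Require Import Coquelicot.
From mathcomp Require Import all_boot all_order all_algebra Rstruct mpoly.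
From mathcomp Require Import ring lra zify.

Set Implicit Arguments.
Unset Strict Implicit.
Unset Printing Implicit Defensive.

Import Order.TTheory GRing.Theory Num.Theory.
Local Open Scope ring_scope.

(** * Gauss's lemma *)

Lemma exists_minimal (T : Type) (P : T -> Prop) (mu : T -> nat) :
  (exists x, P x) -> exists2 x, P x & forall y, P y -> (mu x <= mu y)%N.
Proof.
case=> x0; have [k] := ubnP (mu x0).
elim: k x0 => // k IH x lexk Px.
have [[y Py ltyx]|noy] := classic (exists2 y, P y & (mu y < mu x)%N).
  by apply: IH Py; apply: leq_trans ltyx _.
by exists x => // y Py; rewrite leqNgt; apply/negP => lt; apply: noy; exists y.
Qed.

Lemma irreducible_divisor (F : fieldType) (c : {poly F}) :
  (1 < size c)%N -> exists2 q, irreducible_poly q & q %| c.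
Proof.
move=> c1.
have [|q [q1 qc] qmin] := @exists_minimal {poly F}
  (fun q => (1 < size q)%N /\ q %| c) (fun q => size q).
  by exists c.
exists q => //; split=> // r r1 rq.
have q0 : q != 0 by rewrite -size_poly_gt0 ltnW.
have r0 : r != 0 by apply: contraTneq rq => ->; rewrite dvd0p.
rewrite -dvdp_size_eqp // eqn_leq dvdp_leq //=; apply: qmin; split.
  by rewrite ltn_neqAle eq_sym r1 size_poly_gt0.
exact: dvdp_trans rq qc.
Qed.

(** Otherwise let i and j be the least indices of coefficients of [p] and [q] not divisible by [pi].
    In the coefficient of index i + j of the product all other terms are divisible by [pi], hence so
    is the product of these two, a contradiction. *)
Lemma Gauss_coef_dvdp (F : fieldType) (pi : {poly F}) (p q : {poly {poly F}}) :
  irreducible_poly pi -> (forall i, pi %| (p * q)`_i) ->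
  (forall i, pi %| p`_i) \/ (forall i, pi %| q`_i).
Proof.
move=> irr pq; case: (classic (forall i, pi %| p`_i)); first by left.
move/not_all_ex_not => exi; right; apply: NNPP => /not_all_ex_not exj.
have [i /negP ni imin] := exists_minimal id exi.
have [j /negP nj jmin] := exists_minimal id exj.
have := pq (i + j)%N; rewrite coefM.
have li : (i < (i + j).+1)%N by rewrite ltnS leq_addr.
rewrite (bigD1 (Ordinal li)) //= addKn dvdp_addl.
  rewrite (Gauss_dvdpr); first exact/negP.
  by rewrite irreducible_poly_coprime.
apply: (big_ind (fun x => pi %| x)) => [|x y dx dy|k ki]; first exact: dvdp0.
  by rewrite dvdp_add.
have [ltki|lek] := ltnP k i.
  rewrite dvdp_mulr //; apply: NNPP => nk.
  by have := imin _ nk; rewrite leqNgt ltki.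
rewrite dvdp_mull //; apply: NNPP => nk.
have := jmin _ nk.
have : (nat_of_ord k != i) by apply: contra ki => /eqP e; apply/eqP/val_inj.
by have := ltn_ord k; lia.
Qed.

Lemma coef_dvdp_factor (F : fieldType) (pi : {poly F}) (p : {poly {poly F}}) :
  (forall i, pi %| p`_i) -> exists q, p = pi *: q.
Proof.
move=> dv; exists (\poly_(i < size p) (p`_i %/ pi)).
apply/polyP => i; rewrite coefZ coef_poly.
case: ltnP => [_|le]; first by rewrite mulrC divpK.
by rewrite mulr0 nth_default.
Qed.

(** The generator is chosen of least degree in the outer variable, then with a leading coefficient
    of least degree. Pseudo-division makes some c g, with c a power of that leading coefficient, a
    multiple of [h]; Gauss's lemma then removes the irreducible factors of c one at a time. *)
Lemma prime_ideal_bivariate_principal (F : fieldType)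
    (I : {poly {poly F}} -> Prop) :
  (forall p q, I p -> I q -> I (p - q)) ->
  (forall p q : {poly {poly F}}, I q -> I (p * q)) ->
  (forall p q : {poly {poly F}}, I (p * q) -> I p \/ I q) ->
  (forall c, I c%:P -> c = 0) ->
  (exists2 f, I f & f != 0) ->
  exists2 h, I h & forall g, I g -> exists l, g = l * h.
Proof.
move=> IB IM Iprime IC [f If f0].
have [h1 [Ih1 h10] h1min] := @exists_minimal _ (fun p => I p /\ p != 0)
  (fun p => size p) (ex_intro _ f (conj If f0)).
have [h [Ih h0 lehh1] hmin] := @exists_minimal _
  (fun p => [/\ I p, p != 0 & (size p <= size h1)%N])
  (fun p => size (lead_coef p)) (ex_intro _ h1 (And3 Ih1 h10 (leqnn _))).
exists h => // g Ig.
have cancel k (c : {poly F}) (q g' : {poly {poly F}}) : (size c <= k)%N -> c != 0 ->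
    c *: g' = q * h -> exists l, g' = l * h.
  elim: k c q g' => [|k IH] c q g' lec c0 e.
    by move: lec; rewrite leqn0 size_poly_eq0 (negPf c0).
  have [/size1_polyC ec|c1] := leqP (size c) 1.
    have u0 : c`_0 != 0 by apply: contraNneq c0 => u0; rewrite ec u0.
    move: (c`_0) ec u0 e => u -> u0 e.
    exists (u^-1%:P *: q); rewrite -scalerAl -e scalerA -polyCM.
    by rewrite mulVf // scale1r.
  have [pi irr /dvdpP[c' ec]] := irreducible_divisor c1.
  have pi0 : pi != 0 by rewrite -size_poly_gt0 ltnW // irr.1.
  have c'0 : c' != 0 by apply: contraNneq c0 => c'0; rewrite ec c'0 mul0r.
  have pi1 := irr.1.
  have dv i : pi %| (q * h)`_i by rewrite -e coefZ ec dvdp_mulr // dvdp_mull.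
  (* If [pi] divided [h], the quotient would lie in [I] by primality and have a leading coefficient
     of smaller degree, against the choice of [h]. *)
  have [/coef_dvdp_factor[q' eq']|/coef_dvdp_factor[h' eh]] :=
      Gauss_coef_dvdp irr dv.
    apply: (IH c' q' g') => //.
      by move: lec; rewrite ec size_mul //; move: (size _) (size _) pi1 => m1 m2 pi1; lia.
    apply: (@mulfI _ pi%:P); first by rewrite polyC_eq0.
    by rewrite !mul_polyC scalerA mulrC -ec e eq' scalerAl.
  have h'0 : h' != 0 by apply: contraNneq h0 => h'0; rewrite eh h'0 scaler0.
  have Ih' : I h'.
    have: I (pi%:P * h') by rewrite mul_polyC -eh.
    by case/Iprime => // /IC /eqP; rewrite (negPf pi0).
  have : (size (lead_coef h) <= size (lead_coef h'))%N.
    apply: hmin; split=> //; apply: leq_trans lehh1.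
    by rewrite eh -mul_polyC size_Cmul.
  rewrite eh -mul_polyC lead_coefM lead_coefC size_mul ?lead_coef_eq0 //.
  have: (0 < size (lead_coef h'))%N by rewrite size_poly_gt0 lead_coef_eq0.
  by move: (size _) (size _) pi1 => m1 m2 pi1; lia.
have e := Pdiv.Idomain.divp_eq g h.
set c := lead_coef h ^+ _ in e.
have c0 : c != 0 by rewrite expf_neq0 // lead_coef_eq0.
have Ir : I (g %% h).
  have -> : g %% h = c%:P * g - (g %/ h) * h.
    by rewrite mul_polyC e addrC addKr.
  by apply: IB; apply: IM.
(* The remainder lies in [I] and is shorter than [h], so the minimality of [h1] makes it zero. *)
have r0 : g %% h = 0.
  apply/eqP; apply: contraT => r0.
  have := Pdiv.Idomain.ltn_modp g h; rewrite h0 ltnNge (leq_trans lehh1) //.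
  by apply: h1min.
rewrite r0 addr0 in e.
exact: (cancel (size c) c (g %/ h)).
Qed.

(** * Bivariate polynomials and rational functions of one variable *)

Lemma poly_eq0_horner (p : {poly R}) : (forall s, p.[s] = 0) -> p = 0.
Proof.
move=> p0; apply/eqP; apply: contraT => pn0.
pose rs := [seq (i%:R : R) | i <- iota 0 (size p)].
have /(max_poly_roots pn0) : all (root p) rs by apply/allP => s _; rewrite rootE p0.
rewrite map_inj_uniq ?iota_uniq ?size_map ?size_iota ?ltnn; last first.
  by move=> i j /eqP; rewrite eqr_nat => /eqP.
by move=> /(_ isT).
Qed.

(** Rational functions without real poles, kept as functions on the line. They form an integral
    domain ([regular_mul_eq0]), so a factor that is not identically zero can be cancelled even at
    its zeros. *)
Definition regular_fun (h : R -> R) : Prop :=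
  exists H E : {poly R},
    (forall s, E.[s] != 0) /\ (forall s, E.[s] * h s = H.[s]).

Lemma regular_horner (H : {poly R}) : regular_fun (fun s => H.[s]).
Proof. by exists H, 1; split=> s; rewrite hornerC ?oner_neq0 // mul1r. Qed.

Lemma regular_fun_ext (h k : R -> R) :
  (forall s, h s = k s) -> regular_fun h -> regular_fun k.
Proof. by move=> hk [H [E [E0 e]]]; exists H, E; split=> // s; rewrite -hk. Qed.

Lemma regular_cst (c : R) : regular_fun (fun _ => c).
Proof. by apply: regular_fun_ext (regular_horner c%:P) => s; rewrite hornerC. Qed.

Lemma regularD (h k : R -> R) :
  regular_fun h -> regular_fun k -> regular_fun (fun s => h s + k s).
Proof.
move=> [H [E [E0 e]]] [K [F [F0 f]]]; exists (H * F + K * E), (E * F).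
split=> s; first by rewrite hornerM mulf_neq0.
by rewrite hornerD !hornerM -e -f; ring.
Qed.

Lemma regularM (h k : R -> R) :
  regular_fun h -> regular_fun k -> regular_fun (fun s => h s * k s).
Proof.
move=> [H [E [E0 e]]] [K [F [F0 f]]]; exists (H * K), (E * F).
split=> s; first by rewrite hornerM mulf_neq0.
by rewrite !hornerM -e -f; ring.
Qed.

Lemma regularX (h : R -> R) n : regular_fun h -> regular_fun (fun s => h s ^+ n).
Proof.
move=> rh; elim: n => [|n IH]; first exact: regular_cst.
by apply: regular_fun_ext (regularM rh IH) => s; rewrite exprS.
Qed.

Lemma regular_sum (T : Type) (r : seq T) (P : pred T) (h : T -> R -> R) :
  (forall i, P i -> regular_fun (h i)) ->
  regular_fun (fun s => \sum_(i <- r | P i) h i s).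
Proof.
move=> rh; elim: r => [|i r IH].
  by apply: regular_fun_ext (regular_cst 0) => s; rewrite big_nil.
case Pi: (P i); last by apply: regular_fun_ext IH => s; rewrite big_cons Pi.
by apply: regular_fun_ext (regularD (rh i Pi) IH) => s; rewrite big_cons Pi.
Qed.

Lemma regular_div (H E : {poly R}) :
  (forall s, E.[s] != 0) -> regular_fun (fun s => H.[s] / E.[s]).
Proof. by move=> E0; exists H, E; split=> // s; rewrite mulrC divfK. Qed.

Lemma regular_mul_eq0 (h k : R -> R) : regular_fun h -> regular_fun k ->
  (forall s, h s * k s = 0) -> (forall s, h s = 0) \/ (forall s, k s = 0).
Proof.
move=> [H [E [E0 e]]] [K [F [F0 f]]] hk0.
have /eqP : H * K = 0.
  apply: poly_eq0_horner => s; rewrite hornerM -e -f mulrACA.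
  by rewrite hk0 mulr0.
rewrite mulf_eq0 => /orP[/eqP H0|/eqP K0]; [left|right] => s.
  by move: (e s); rewrite H0 horner0 => /eqP; rewrite mulf_eq0 (negPf (E0 s)) => /eqP.
by move: (f s); rewrite K0 horner0 => /eqP; rewrite mulf_eq0 (negPf (F0 s)) => /eqP.
Qed.

Lemma eval2D g h x y : eval2 (g + h) x y = eval2 g x y + eval2 h x y.
Proof. exact: mevalD. Qed.
Lemma eval2B g h x y : eval2 (g - h) x y = eval2 g x y - eval2 h x y.
Proof. exact: mevalB. Qed.
Lemma eval2M g h x y : eval2 (g * h) x y = eval2 g x y * eval2 h x y.
Proof. exact: mevalM. Qed.
Lemma eval2Z c g x y : eval2 (c *: g) x y = c * eval2 g x y.
Proof. exact: mevalZ. Qed.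
Lemma eval2C c x y : eval2 c%:MP x y = c.
Proof. exact: mevalC. Qed.
Lemma eval2X g n x y : eval2 (g ^+ n) x y = eval2 g x y ^+ n.
Proof. exact: rmorphXn. Qed.
Lemma eval2_sum (T : Type) (r : seq T) (P : pred T) (g : T -> poly2) x y :
  eval2 (\sum_(i <- r | P i) g i) x y = \sum_(i <- r | P i) eval2 (g i) x y.
Proof. exact: raddf_sum. Qed.
Lemma eval2_mon (m : 'X_{1..2}) x y :
  eval2 'X_[m] x y = x ^+ m ord0 * y ^+ m ord_max.
Proof.
rewrite /eval2 mevalX big_ord_recl big_ord1 /=.
by congr (_ * _ ^+ m _); apply: val_inj.
Qed.

Lemma mdeg2 (m : 'X_{1..2}) : mdeg m = (m ord0 + m ord_max)%N.
Proof.
by rewrite mdegE big_ord_recl big_ord1; congr (_ + m _)%N; apply: val_inj.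
Qed.

Lemma mpoly2_ind (P : poly2 -> Prop) :
  (forall c, P c%:MP) -> P 'X_ord0 -> P 'X_ord_max ->
  (forall g h, P g -> P h -> P (g + h)) -> (forall g h, P g -> P h -> P (g * h)) ->
  forall g, P g.
Proof.
move=> PC P0 P1 PD PM; elim/mpolyind => [|c m g _ _ Pg].
  by rewrite -[0]mpolyC0; apply: PC.
apply: (PD) => //; rewrite -mul_mpolyC; apply: (PM) => //; rewrite mpolyXE_id.
apply: (big_ind P) => [||i _]; [by rewrite -[1]mpolyC1|by []|].
have Pi : P 'X_i.
  case: (unliftP ord0 i) => [j ->|-> //].
  by rewrite (_ : lift _ _ = ord_max) //; apply: val_inj; case: j => [[]].
by elim: (m i) => [|k IH]; [rewrite -[_ ^+ _]mpolyC1 | rewrite exprS; apply: (PM)].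
Qed.

Lemma regular_eval2 g (h k : R -> R) :
  regular_fun h -> regular_fun k -> regular_fun (fun s => eval2 g (h s) (k s)).
Proof.
move=> rh rk; elim/mpoly2_ind: g => [c| | |g g' IH IH'|g g' IH IH'].
- by apply: regular_fun_ext (regular_cst c) => s; rewrite eval2C.
- by apply: regular_fun_ext rh => s; rewrite /eval2 mevalXU.
- by apply: regular_fun_ext rk => s; rewrite /eval2 mevalXU.
- by apply: regular_fun_ext (regularD IH IH') => s; rewrite eval2D.
- by apply: regular_fun_ext (regularM IH IH') => s; rewrite eval2M.
Qed.

(** The outer variable becomes y and the inner one x. Divisibility questions are lifted along this
    surjection to R[x][y], where pseudo-division is available. *)
Definition poly_to_mpoly2 : {rmorphism {poly {poly R}} -> poly2} :=
  horner_eval ('X_ord_max : poly2) \o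
  map_poly (horner_eval ('X_ord0 : poly2) \o map_poly (@mpolyC 2 R)).

Lemma poly_to_mpoly2X : poly_to_mpoly2 'X = 'X_ord_max.
Proof. by rewrite /= map_polyX /horner_eval hornerX. Qed.

Lemma poly_to_mpoly2C (q : {poly R}) :
  poly_to_mpoly2 q%:P = (map_poly (@mpolyC 2 R) q).['X_ord0].
Proof. by rewrite /= map_polyC /horner_eval hornerC. Qed.

Lemma poly_to_mpoly2E (p : {poly {poly R}}) x y :
  eval2 (poly_to_mpoly2 p) x y = p.[y%:P].[x].
Proof.
have e1 (q : {poly R}) : eval2 (map_poly (@mpolyC 2 R) q).['X_ord0] x y = q.[x].
  elim/poly_ind: q => [|q c IH]; first by rewrite rmorph0 !horner0 eval2C.
  rewrite rmorphD rmorphM /= map_polyX map_polyC !hornerMXaddC eval2D eval2M IH.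
  by rewrite eval2C /eval2 mevalXU.
elim/poly_ind: p => [|p c IH].
  by rewrite rmorph0 !horner0 eval2C.
rewrite rmorphD rmorphM eval2D eval2M IH poly_to_mpoly2X poly_to_mpoly2C e1.
by rewrite hornerMXaddC hornerD hornerM hornerC /eval2 mevalXU.
Qed.

Lemma poly_to_mpoly2_onto (g : poly2) : exists p, poly_to_mpoly2 p = g.
Proof.
elim/mpoly2_ind: g => [c| | |g h [p <-] [q <-]|g h [p <-] [q <-]].
- by exists c%:P%:P; rewrite poly_to_mpoly2C map_polyC hornerC.
- by exists ('X)%:P; rewrite poly_to_mpoly2C map_polyX hornerX.
- by exists 'X; rewrite poly_to_mpoly2X.
- by exists (p + q); rewrite rmorphD.
- by exists (p * q); rewrite rmorphM.
Qed.

(** * The degree of a rationally parametrized curve *)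

(** Modulo [D] only the term [A ^+ e * C e] survives; [A] is prime to [D] and [C e] is shorter than
    [D], so [C e] is zero. The rest is divisible by [D], and induction applies to the quotient. *)
Lemma adic_independent (A D : {poly R}) n (C : nat -> {poly R}) e :
  coprimep A D -> (n < size D)%N -> (forall j, (size (C j) <= n)%N) ->
  \sum_(j < e.+1) A ^+ j * D ^+ (e - j) * C j = 0 ->
  forall j, (j <= e)%N -> C j = 0.
Proof.
move=> cop ltD sC.
have D0 : D != 0 by rewrite -size_poly_gt0; apply: leq_ltn_trans ltD.
have small k : D %| A ^+ k * C k -> C k = 0.
  rewrite Gauss_dvdpr; last by rewrite coprimep_expr // coprimep_sym.
  move=> dv; apply/eqP; apply: contraT => Ck0.
  by have := leq_trans (dvdp_leq Ck0 dv) (sC k); rewrite leqNgt ltD.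
elim: e => [|e IH].
  rewrite big_ord1 subnn expr0 mulr1 => s0 [|//] _.
  by apply: small; rewrite s0 dvdp0.
rewrite big_ord_recr /= subnn expr0 mulr1.
have -> : \sum_(j < e.+1) A ^+ j * D ^+ (e.+1 - j) * C j =
    D * \sum_(j < e.+1) A ^+ j * D ^+ (e - j) * C j.
  rewrite mulr_sumr; apply: eq_bigr => j _.
  by rewrite subSn ?exprS; [ring | rewrite -ltnS].
move=> s0.
have Ce : C e.+1 = 0.
  apply: small; move/eqP: s0; rewrite addrC addr_eq0 => /eqP ->.
  by rewrite dvdpNr dvdp_mulr.
move: s0; rewrite Ce mulr0 addr0 => /eqP.
rewrite mulf_eq0 (negPf D0) /= => /eqP /IH C0 j.
by rewrite leq_eqVlt => /orP[/eqP -> //|]; apply: C0.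
Qed.

(** A matrix with more rows than columns has a nonzero vector in its left kernel. *)
Lemma independent_card_le (I J : finType) (M : I -> J -> R) :
  (forall c : I -> R, (forall j, \sum_i c i * M i j = 0) -> forall i, c i = 0) ->
  (#|I| <= #|J|)%N.
Proof.
move=> indep; rewrite leqNgt; apply/negP => ltJI.
pose Mx : 'M[R]_(#|I|, #|J|) := \matrix_(i, j) M (enum_val i) (enum_val j).
have : kermx Mx != 0.
  rewrite kermx_eq0 /row_free; apply/negP => /eqP rk.
  by have := rank_leq_col Mx; rewrite rk leqNgt ltJI.
case/rowV0Pn => v /sub_kermxP vM v0.
move/eqP: v0; apply; apply/rowP => i; rewrite mxE.
have := indep (fun i => v 0 (enum_rank i)) _ (enum_val i).
rewrite enum_valK; apply=> j.
have := congr1 (fun w : 'rV_#|J| => w 0 (enum_rank j)) vM.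
rewrite mxE [RHS]mxE => e; rewrite -[RHS]e.
rewrite (reindex_onto enum_val enum_rank) /=; last by move=> k _; rewrite enum_rankK.
apply: eq_big => [k|k _]; first by rewrite enum_valK eqxx.
by rewrite mxE enum_valK !enum_rankK.
Qed.

Lemma poly_independent_card_le (I : finType) (P : I -> {poly R}) m :
  (forall i, (size (P i) <= m)%N) ->
  (forall c : I -> R, \sum_i c i *: P i = 0 -> forall i, c i = 0) ->
  (#|I| <= m)%N.
Proof.
move=> sP indep; rewrite -[X in (_ <= X)%N]card_ord.
apply: (@independent_card_le _ _ (fun i (j : 'I_m) => (P i)`_j)) => c cM.
apply: indep; apply/polyP => j; rewrite coef0 coef_sum.
have [ltj|lej] := ltnP j m.
  by rewrite -[RHS](cM (Ordinal ltj)); apply: eq_bigr => i _; rewrite coefZ.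
apply: big1 => i _.
by rewrite coefZ [_`__]nth_default ?mulr0 // (leq_trans (sP i)).
Qed.

Definition on_param (A B D : {poly R}) (g : poly2) (s : R) : R :=
  eval2 g (A.[s] / D.[s])%R (B.[s] / D.[s])%R.

Lemma on_paramB A B D g h s :
  on_param A B D (g - h) s = on_param A B D g s - on_param A B D h s.
Proof. exact: eval2B. Qed.

Lemma on_paramM A B D g h s :
  on_param A B D (g * h) s = on_param A B D g s * on_param A B D h s.
Proof. exact: eval2M. Qed.

Lemma regular_on_param A B D g :
  (forall s, D.[s] != 0) -> regular_fun (on_param A B D g).
Proof. by move=> D0; apply: regular_eval2; apply: regular_div. Qed.

(** The polynomials vanishing on the parametrized curve form a prime ideal, because regular
    functions form a domain, and [adic_independent] shows that it contains no nonzero polynomial in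
    x alone. It is therefore principal, and the irreducible [f] is a constant times its
    generator. *)
Lemma irreducible2_dvd_vanishing (A B D : {poly R}) (f g : poly2) :
  (forall s, D.[s] != 0) -> coprimep A D -> (1 < size D)%N ->
  irreducible2 f -> (forall s, on_param A B D f s = 0) ->
  (forall s, on_param A B D g s = 0) -> exists h, g = h * f.
Proof.
move=> D0 cop sD [f1 firr] fv gv.
have f0 : f != 0 by rewrite -msize_poly_eq0; move: f1; case: (msize f).
pose I (p : {poly {poly R}}) := forall s, on_param A B D (poly_to_mpoly2 p) s = 0.
have [pf epf] := poly_to_mpoly2_onto f; have [pg epg] := poly_to_mpoly2_onto g.
have [|||||h Ih hI] := @prime_ideal_bivariate_principal _ I.
- by move=> p q Ip Iq s; rewrite rmorphB on_paramB (Ip s) (Iq s) subr0.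
- by move=> p q Iq s; rewrite rmorphM on_paramM (Iq s) mulr0.
- move=> p q Ipq; apply: regular_mul_eq0; try exact: regular_on_param.
  by move=> s; rewrite -on_paramM -rmorphM; apply: Ipq.
- move=> c Ic; apply/polyP => i; rewrite coef0.
  have [le|lt] := leqP (size c) i; first by rewrite nth_default.
  have : (c`_i)%:P = 0; last by move/eqP; rewrite polyC_eq0 => /eqP.
  (* The coefficients are constants, so the size bound is 1. Clearing denominators with exponent
     [size c], one above the degree, only adds a term whose coefficient is the default value 0. *)
  apply: (@adic_independent A D 1 (fun i => (c`_i)%:P) (size c)) (ltnW lt) => //.
    by move=> j; apply: size_polyC_leq1.
  apply: poly_eq0_horner => s; rewrite horner_sum big_ord_recr /= nth_default //.
  rewrite hornerM hornerC mulr0 addr0.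
  have := Ic s; rewrite /on_param poly_to_mpoly2E hornerC horner_coef.
  move/(congr1 (fun z => D.[s] ^+ size c * z)); rewrite mulr0 => e.
  rewrite -[RHS]e mulr_sumr; apply: eq_bigr => j _.
  rewrite !hornerM !horner_exp hornerC expr_div_n.
  have -> : D.[s] ^+ size c = D.[s] ^+ (size c - j) * D.[s] ^+ j.
    by rewrite -exprD subnK // ltnW.
  by field; rewrite expf_neq0.
- exists pf; first by move=> s; rewrite epf; apply: fv.
  by apply: contraNneq f0 => pf0; rewrite -epf pf0 rmorph0.
have [l el] : exists l, pf = l * h by apply: hI => s; rewrite epf; apply: fv.
have [k ek] : exists k, pg = k * h by apply: hI => s; rewrite epg; apply: gv.
have ef : f = poly_to_mpoly2 l * poly_to_mpoly2 h by rewrite -rmorphM -el.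
have eg : g = poly_to_mpoly2 k * poly_to_mpoly2 h by rewrite -rmorphM -ek.
(* The generator [h] cannot be constant: it vanishes on the curve, so it would be zero, and [f] with
   it. *)
have [/msize1_polyC lc|/msize1_polyC hc] := firr _ _ ef; last first.
  have := Ih 0; rewrite /on_param hc eval2C => h0.
  by move: f0; rewrite ef hc h0 mulr0 eqxx.
set c := _@_0 in lc.
have c0 : c != 0 by apply: contraNneq f0 => c0; rewrite ef lc c0 mul0r.
exists (c^-1 *: poly_to_mpoly2 k); rewrite eg ef lc mul_mpolyC.
by rewrite -scalerAr -scalerAl scalerA divff // scale1r.
Qed.

Definition mon2 (i j : nat) : 'X_{1..2} :=
  [multinom (if val k == 0%N then i else j) | k < 2].

Lemma mon2_fst i j : mon2 i j ord0 = i.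
Proof. by rewrite mnmE. Qed.

Lemma mon2_snd i j : mon2 i j ord_max = j.
Proof. by rewrite mnmE. Qed.

Lemma mon2_eta (m : 'X_{1..2}) : mon2 (m ord0) (m ord_max) = m.
Proof.
apply/mnmP => k; rewrite mnmE; case: (unliftP ord0 k) => [j|] -> //=.
by congr (m _); apply: val_inj; case: j => [[]].
Qed.

Lemma mon2_inj i j i' j' : mon2 i j = mon2 i' j' -> i = i' /\ j = j'.
Proof.
by move=> e; rewrite -(mon2_fst i j) -{2}(mon2_snd i j) e mon2_fst mon2_snd.
Qed.

Lemma mdeg_mon2 i j : mdeg (mon2 i j) = (i + j)%N.
Proof. by rewrite mdeg2 mon2_fst mon2_snd. Qed.

(** With x^p y^q the leading monomial of [f], the monomials x^a y^k (a < p) and x^(p+k) y^b (b < q),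
    for k < K, are not divisible by it. No nontrivial combination of them is a multiple of [f], so
    they stay independent on the curve. Multiplied by [D ^+ e] they become polynomials in s of
    degree at most n e, where e = d + K. *)
Lemma total_degree_le_param (A B D : {poly R}) (f : poly2) n :
  (forall s, D.[s] != 0) -> coprimep A D -> (1 < size D)%N ->
  (size A <= n.+1)%N -> (size B <= n.+1)%N -> (size D <= n.+1)%N ->
  irreducible2 f -> (forall s, on_param A B D f s = 0) ->
  (total_degree f <= n)%N.
Proof.
move=> D0 cop sD1 sA sB sD irr fv.
have f1 := irr.1.
have f0 : f != 0 by rewrite -msize_poly_eq0; move: f1; case: (msize f).
pose p := mlead f ord0; pose q := mlead f ord_max.
have ed : total_degree f = (p + q)%N.
  by rewrite /total_degree -(mlead_deg f0) /= mdeg2.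
set d := total_degree f in ed *.
suff bound K : (d * K <= n * (d + K) + 1)%N.
  (* If d > n, the bound would give K <= n d + 1 for every K. *)
  by have := bound (n * d).+2; nia.
pose e := (d + K)%N.
pose mon (i : ('I_p + 'I_q) * 'I_K) : 'X_{1..2} :=
  match i.1 with inl a => mon2 a i.2 | inr b => mon2 (p + i.2) b end.
have mon_inj : injective mon.
  move=> [[a|b] k] [[a'|b'] k']; rewrite /mon /= => /mon2_inj [e3 e2].
  - by congr (inl _, _); apply: val_inj.
  - by have := ltn_ord a; rewrite e3 ltnNge leq_addr.
  - by have := ltn_ord a'; rewrite -e3 ltnNge leq_addr.
  - by congr (inr _, _); apply: val_inj => //; apply: (@addnI p).
have mon_deg i : (mdeg (mon i) <= e)%N.
  case: i => [[a|b] k]; rewrite /mon /= mdeg_mon2 /e ed.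
    by have := ltn_ord a; have := ltn_ord k; lia.
  by have := ltn_ord b; have := ltn_ord k; lia.
have mon_std i m : mon i = (m + mlead f)%MM -> False.
  case: i => [[a|b] k]; rewrite /mon /= => e1.
    have := congr1 (fun m : 'X_{1..2} => m ord0) e1.
    rewrite /= mon2_fst mnmDE -/p => e2.
    by have := ltn_ord a; rewrite e2 ltnNge leq_addl.
  have := congr1 (fun m : 'X_{1..2} => m ord_max) e1.
  rewrite /= mon2_snd mnmDE -/q => e2.
  by have := ltn_ord b; rewrite e2 ltnNge leq_addl.
have <- : #|{: ('I_p + 'I_q) * 'I_K}| = (d * K)%N.
  by rewrite card_prod card_sum !card_ord ed.
rewrite -/e addn1; pose P i := A ^+ mon i ord0 * B ^+ mon i ord_max * D ^+ (e - mdeg (mon i)).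
apply: (@poly_independent_card_le _ P).
  move=> i; rewrite /P; have := mon_deg i; rewrite mdeg2.
  move: (mon i ord0) (mon i ord_max) => a b le.
  have sX (r : {poly R}) k : (size r <= n.+1)%N -> (size (r ^+ k) <= (n * k).+1)%N.
    move=> sr; apply: leq_trans (size_exp_leq _ _) _.
    by rewrite ltnS leq_mul2r; move: (size r) sr => u; lia.
  apply: leq_trans (size_mul_leq _ _) _.
  have := size_mul_leq (A ^+ a) (B ^+ b).
  have := sX _ a sA; have := sX _ b sB; have := sX _ (e - (a + b))%N sD.
  have : (n * (e - (a + b)) + n * a + n * b = n * e)%N.
    by rewrite -!mulnDr; congr (n * _)%N; lia.
  move: (n * _)%N (n * _)%N (n * _)%N (n * _)%N => u1 u2 u3 u4.
  move: (size _) (size _) (size _) (size _) => v1 v2 v3 v4.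
  lia.
move=> c cP.
pose g : poly2 := \sum_i c i *: 'X_[mon i].
have coef_g m : g@_m = \sum_i c i * (mon i == m)%:R.
  by rewrite /g raddf_sum; apply: eq_bigr => i _; rewrite /= mcoeffZ mcoeffX.
have gv s : on_param A B D g s = 0.
  have De : D.[s] ^+ e != 0 by rewrite expf_neq0.
  apply: (mulfI De); rewrite mulr0 -[RHS](horner0 s) -cP horner_sum /on_param.
  rewrite eval2_sum mulr_sumr; apply: eq_bigr => i _.
  rewrite eval2Z eval2_mon hornerZ /P !hornerM !horner_exp !expr_div_n.
  have -> : D.[s] ^+ e = D.[s] ^+ (e - mdeg (mon i)) *
      (D.[s] ^+ mon i ord0 * D.[s] ^+ mon i ord_max).
    by rewrite -!exprD -mdeg2 subnK.
  have := expf_neq0 (mon i ord0) (D0 s); have := expf_neq0 (mon i ord_max) (D0 s).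
  move: (D.[s] ^+ mon i ord0) (D.[s] ^+ mon i ord_max) (D.[s] ^+ _) => u v k v0 u0.
  move: (A.[s] ^+ _) (B.[s] ^+ _) => a b.
  by field; rewrite u0 v0.
have g0 : g = 0.
  apply/eqP; apply: contraT => gn0.
  have [h eh] := irreducible2_dvd_vanishing D0 cop sD1 irr fv gv.
  have h0 : h != 0 by apply: contraNneq gn0 => h0; rewrite eh h0 mul0r.
  have := mlead_supp gn0; rewrite mcoeff_msupp coef_g eh mleadM //.
  case/eqP; apply: big1 => i _.
  by case: eqP => [/mon_std //|_]; rewrite mulr0.
move=> i; have := coef_g (mon i); rewrite g0 mcoeff0 (bigD1 i) //= eqxx mulr1.
rewrite big1 ?addr0 // => j ji.
by rewrite (inj_eq mon_inj) (negPf ji) mulr0.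
Qed.

(** * Counting monomials, and the lower bound for the degree *)

Lemma msizeM_leS (g h : poly2) a b :
  (msize g <= a.+1)%N -> (msize h <= b.+1)%N -> (msize (g * h) <= (a + b).+1)%N.
Proof.
have [->|g0] := eqVneq g 0; first by rewrite mul0r msize0.
have [->|h0] := eqVneq h 0; first by rewrite mulr0 msize0.
by rewrite msizeM //; move: (msize g) (msize h) => u v; lia.
Qed.

Lemma msizeX_leS (g : poly2) a k :
  (msize g <= a.+1)%N -> (msize (g ^+ k) <= (k * a).+1)%N.
Proof.
move=> sg; elim: k => [|k IH]; first by rewrite msize1.
by rewrite exprS mulSn msizeM_leS.
Qed.

(** The pairs (i, j) with i + j <= k, which index the bivariate monomials of degree at most k. *)
Definition triangle (k : nat) : finType := {i : 'I_k.+1 & 'I_(k.+1 - i)}.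

Lemma card_triangle k : #|triangle k| = (\sum_(i < k.+1) (k.+1 - i))%N.
Proof.
by rewrite card_tagged sumnE big_map big_enum; apply: eq_big => // i _; rewrite card_ord.
Qed.

(** Each of the d added diagonals has at most k + d + 1 points. *)
Lemma card_triangle_addn k d :
  (#|triangle (k + d)| <= #|triangle k| + d * (k + d).+1)%N.
Proof.
elim: d => [|d IH]; first by rewrite addn0 leq_addr.
have step : #|triangle (k + d.+1)| = (#|triangle (k + d)| + (k + d).+2)%N.
  by rewrite addnS !card_triangle big_ord_recl subn0 addnC.
rewrite step mulSn; apply: leq_trans (leq_add IH (leqnn _)) _.
by rewrite addnS; nia.
Qed.

Definition triangle_mon k (t : triangle k) : 'X_{1..2} := mon2 (tag t) (tagged t).

Lemma triangle_mon_inj k : injective (@triangle_mon k).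
Proof.
move=> [i j] [i' j'] /mon2_inj /= [/val_inj ei]; case: i' / ei j' => j' /val_inj ej.
by rewrite ej.
Qed.

Lemma mdeg_triangle_mon k (t : triangle k) : (mdeg (triangle_mon t) <= k)%N.
Proof. by case: t => i j; rewrite mdeg_mon2 /=; have := ltn_ord j; lia. Qed.

Lemma triangle_mon_onto k (m : 'X_{1..2}) :
  (mdeg m <= k)%N -> exists t : triangle k, triangle_mon t = m.
Proof.
rewrite mdeg2 => le.
have li : (m ord0 < k.+1)%N by lia.
have lj : (m ord_max < k.+1 - Ordinal li)%N by rewrite /=; lia.
exists (@existT _ (fun i : 'I_k.+1 => 'I_(k.+1 - i)) (Ordinal li) (Ordinal lj)).
by rewrite /triangle_mon /= mon2_eta.
Qed.

Lemma mpoly_independent_card_le (I : finType) (G : I -> poly2) k :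
  (forall i, (msize (G i) <= k.+1)%N) ->
  (forall c : I -> R, \sum_i c i *: G i = 0 -> forall i, c i = 0) ->
  (#|I| <= #|triangle k|)%N.
Proof.
move=> sG indep.
apply: (@independent_card_le _ _ (fun i t => (G i)@_(triangle_mon t))) => c cM.
apply: indep; apply/mpolyP => m; rewrite mcoeff0 raddf_sum /=.
have [/triangle_mon_onto[t <-]|gt] := leqP (mdeg m) k.
  by rewrite -[RHS](cM t); apply: eq_bigr => i _; rewrite mcoeffZ.
apply: big1 => i _; rewrite mcoeffZ memN_msupp_eq0 ?mulr0 //.
by apply: msize_mdeg_ge; apply: leq_trans (sG i) _.
Qed.

(* The witnesses [P], [Q] say that the parameter is the rational function [P / Q]
   of the point, so that the parametrization is generically injective. *)
Lemma total_degree_ge_param (A B D : {poly R}) (f P Q : poly2) n :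
  (forall s, D.[s] != 0) -> coprimep A D -> size D = n.+1 ->
  f != 0 -> (forall s, on_param A B D f s = 0) ->
  ~ (forall s, on_param A B D Q s = 0) ->
  (forall s, s * on_param A B D Q s = on_param A B D P s) ->
  (n <= total_degree f)%N.
Proof.
move=> D0 cop sD f0 fv Qn0 PQ.
set d := total_degree f; pose w := maxn (msize P) (msize Q); pose r := (n.-1 * w)%N.
have sf : (msize f <= d.+1)%N by rewrite /d /total_degree; case: (msize f).
suff bound e : (n * e.+1 <= d * (e + r + d).+1)%N.
  (* If d < n, the left side is at least (d + 1) (e + 1), which exceeds the right side by exactly 1
     at e = d (r + d). *)
  by rewrite leqNgt; apply/negP => lt; have := bound (d * (r + d))%N; nia.
have := card_triangle_addn (e + r) d.
suff: (n * e.+1 + #|triangle (e + r)| <= #|triangle (e + r + d)|)%N by lia.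
have -> : (n * e.+1 + #|triangle (e + r)|)%N =
    #|{: 'I_e.+1 * 'I_n + triangle (e + r)}|.
  by rewrite card_sum card_prod !card_ord mulnC.
(* On the curve P^i Q^(n-1-i) equals s^i Q^(n-1), so the first family restricts to the functions x^j
   s^i times a common factor, at a cost of at most r in degree. The multiples of [f] restrict to
   zero. The union turns out to be independent in degree at most e + r + d. *)
pose G (i : 'I_e.+1 * 'I_n + triangle (e + r)) : poly2 :=
  match i with
  | inl (j, i) => 'X_ord0 ^+ j * (P ^+ i * Q ^+ (n.-1 - i))
  | inr t => 'X_[triangle_mon t] * f
  end.
apply: (@mpoly_independent_card_le _ G).
  have sP : (msize P <= w.+1)%N by rewrite ltnW // ltnS leq_maxl.
  have sQ : (msize Q <= w.+1)%N by rewrite ltnW // ltnS leq_maxr.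
  case=> [[j i]|t] /=.
    have sX : (msize ('X_ord0 : poly2) <= 2)%N by rewrite msizeX mdeg1.
    have := msizeM_leS (msizeX_leS j sX)
      (msizeM_leS (msizeX_leS i sP) (msizeX_leS (n.-1 - i) sQ)).
    move=> le; apply: leq_trans le _; rewrite -mulnDl subnKC; last first.
      by have := ltn_ord i; lia.
    by rewrite -/r; have := ltn_ord j; lia.
  apply: leq_trans (msizeM_leS _ sf) _; first by rewrite msizeX ltnS; apply: mdeg_triangle_mon.
  by [].
move=> c; rewrite big_sumType /= => c0.
have ev0 s : \sum_(k : 'I_e.+1 * 'I_n)
    c (inl k) * ((A.[s] / D.[s]) ^+ k.1 * s ^+ k.2) * on_param A B D Q s ^+ n.-1 = 0.
  have := congr1 (fun g => on_param A B D g s) c0; rewrite /on_param eval2D.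
  rewrite !eval2_sum eval2C [X in _ + X]big1 ?addr0 => [e0|t _]; last first.
    by rewrite eval2Z eval2M [X in _ * (_ * X)](fv s) !mulr0.
  rewrite -[RHS]e0; apply: eq_bigr => -[j i] _ /=.
  rewrite eval2Z !eval2M !eval2X -/(on_param A B D P s) -/(on_param A B D Q s) -PQ.
  rewrite /eval2 mevalXU /= [(s * _) ^+ i]exprMn.
  have -> : on_param A B D Q s ^+ n.-1 =
      on_param A B D Q s ^+ i * on_param A B D Q s ^+ (n.-1 - i).
    by rewrite -exprD subnKC //; have := ltn_ord i; lia.
  by ring.
(* The coefficients of x^j are gathered into one polynomial in s of degree less than n, as
   [adic_independent] requires; [insub] extends them by 0 outside the index range. *)
pose C (j : nat) : {poly R} := \poly_(i < n)
  (if insub j is Some j' then if insub i is Some i' then c (inl (j', i')) else 0 else 0).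
have C0 : forall j, (j <= e)%N -> C j = 0.
  apply: (@adic_independent A D n) => //; first by rewrite sD.
    by move=> j; apply: size_poly.
  apply: poly_eq0_horner => s; rewrite horner_sum.
  pose S s := \sum_(j < e.+1) (A.[s] / D.[s]) ^+ j * (C j).[s].
  (* The common power of [Q] is cancelled in the domain of regular functions. *)
  have S0 : forall s, S s = 0.
    have [| | |//|Q0] := @regular_mul_eq0 S (fun s => on_param A B D Q s ^+ n.-1).
    - apply: regular_sum => j _; apply: regularM; last exact: regular_horner.
      by apply: regularX; apply: regular_div.
    - by apply: regularX; apply: regular_on_param.
    - move=> s'; rewrite -[RHS](ev0 s') /S -mulr_suml; congr (_ * _).
      rewrite (eq_bigr (fun j : 'I_e.+1 => \sum_(i < n)
        c (inl (j, i)) * ((A.[s'] / D.[s']) ^+ j * s' ^+ i))).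
        by rewrite pair_bigA; apply: eq_bigr => -[].
      move=> j _; rewrite horner_poly mulr_sumr; apply: eq_bigr => i _.
      by rewrite !valK; ring.
    - case: Qn0 => s'; apply/eqP; have := Q0 s' => /eqP.
      by rewrite expf_eq0 => /andP[].
  have De : D.[s] ^+ e != 0 by rewrite expf_neq0.
  transitivity (D.[s] ^+ e * S s); last by rewrite S0 mulr0.
  rewrite mulr_sumr; apply: eq_bigr => j _.
  have -> : D.[s] ^+ e = D.[s] ^+ (e - j) * D.[s] ^+ j.
    by rewrite -exprD subnK // -ltnS.
  rewrite !hornerM !horner_exp expr_div_n.
  have := expf_neq0 j (D0 s); move: (D.[s] ^+ j) (D.[s] ^+ _) => u k u0.
  by field.
have cl k : c (inl k) = 0.
  case: k => j i; have := congr1 (fun p : {poly R} => p`_i) (C0 j (ltn_ord j)).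
  by rewrite coef0 coef_poly ltn_ord !valK.
(* What remains is a polynomial times the nonzero [f], so that polynomial is zero. *)
have gf0 : (\sum_t c (inr t) *: 'X_[triangle_mon t] : poly2) = 0.
  apply/eqP; move: c0; rewrite big1 => [|k _]; last by rewrite cl scale0r.
  rewrite add0r; under eq_bigr do rewrite -/(G _) /= scalerAl.
  by rewrite -mulr_suml => /eqP; rewrite mulf_eq0 (negPf f0) orbF.
case=> [//|t].
have := congr1 (mcoeff (triangle_mon t)) gf0; rewrite mcoeff0 raddf_sum /=.
rewrite (bigD1 t) //= mcoeffZ mcoeffX eqxx mulr1 big1 ?addr0 // => t' tt'.
by rewrite mcoeffZ mcoeffX (inj_eq (@triangle_mon_inj _)) (negPf tt') mulr0.
Qed.

(** * Trigonometric polynomials as rational functions *)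

Lemma cosD (x y : R) : cos (x + y)%R = cos x * cos y - sin x * sin y.
Proof. exact: cos_plus. Qed.

Lemma sinD (x y : R) : sin (x + y)%R = sin x * cos y + cos x * sin y.
Proof. exact: sin_plus. Qed.

Lemma cosN (x : R) : cos (- x)%R = cos x.
Proof. exact: cos_neg. Qed.

Lemma sinN (x : R) : sin (- x)%R = - sin x.
Proof. exact: sin_neg. Qed.

Lemma cos2Dsin2 (x : R) : cos x ^+ 2 + sin x ^+ 2 = 1.
Proof. by have := sin2_cos2 x; rewrite /Rsqr /= => e; rewrite !expr2 addrC. Qed.

Lemma cos_atan_gt0 (s : R) : 0 < cos (atan s).
Proof.
have [h1 h2] := atan_bound s; apply/RltP; apply: cos_gt_0 => //.
by apply: Rle_lt_trans h1; rewrite /Rdiv Ropp_mult_distr_l; apply: Rle_refl.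
Qed.

Lemma sin_atan_cos (s : R) : sin (atan s) = s * cos (atan s).
Proof.
have c0 : cos (atan s) != 0 by rewrite gt_eqF // cos_atan_gt0.
by rewrite -{2}(tan_atan s) /tan RealsE divfK.
Qed.

Lemma cos2_atan (s : R) : (1 + s ^+ 2) * cos (atan s) ^+ 2 = 1.
Proof. by rewrite -[RHS](cos2Dsin2 (atan s)) sin_atan_cos; ring. Qed.

(* The quadratic [1 + 'X^2] clears the denominators of [cos] and [sin] at the
   angle [2 * atan s]. *)
Definition q1 : {poly R} := 1 + 'X^2.

Lemma q1E s : q1.[s] = 1 + s ^+ 2.
Proof. by rewrite /q1 !hornerE. Qed.

Lemma q1_neq0 s : q1.[s] != 0.
Proof. by rewrite q1E gt_eqF // ltr_pwDl // sqr_ge0. Qed.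

Lemma size_q1 : size q1 = 3.
Proof. by rewrite /q1 addrC size_polyDl size_polyXn ?size_poly1. Qed.

Lemma size_q1X M : size (q1 ^+ M) = (M.*2).+1.
Proof.
rewrite -[LHS]prednK ?size_exp ?size_q1 ?mul2n // size_poly_gt0 expf_neq0 //.
by rewrite -size_poly_gt0 size_q1.
Qed.

(** Numerators of cos(2 k u) and sin(2 k u) over (1 + s^2)^k, for u = atan s. The recursion is the
    addition formula with cos 2u = (1 - s^2) / (1 + s^2) and sin 2u = 2 s / (1 + s^2). *)
Fixpoint cos_sin_num (k : nat) : {poly R} * {poly R} :=
  if k is k'.+1 then
    let: (C, T) := cos_sin_num k' in
    ((1 - 'X^2) * C - 2%:P * 'X * T, (1 - 'X^2) * T + 2%:P * 'X * C)
  else (1, 0).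

Lemma cos_sin_numS k :
  cos_sin_num k.+1 =
  ((1 - 'X^2) * (cos_sin_num k).1 - 2%:P * 'X * (cos_sin_num k).2,
   (1 - 'X^2) * (cos_sin_num k).2 + 2%:P * 'X * (cos_sin_num k).1).
Proof. by rewrite /=; case: (cos_sin_num k). Qed.

Lemma size_cos_sin_num k :
  (size (cos_sin_num k).1 <= (k.*2).+1)%N /\ (size (cos_sin_num k).2 <= (k.*2).+1)%N.
Proof.
elim: k => [|k]; first by rewrite /= size_poly1 size_poly0.
rewrite doubleS /=; case: (cos_sin_num k) => C T /= [sC sT].
have s1 : (size ((1 - 'X^2)%R : {poly R}) <= 3)%N.
  rewrite (leq_trans (size_polyD _ _)) // size_polyN size_polyXn size_poly1.
  by [].
have s2 : (size ((2%:P * 'X)%R : {poly R}) <= 3)%N.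
  apply: leq_trans (size_mul_leq _ _) _; rewrite size_polyX.
  by have := size_polyC_leq1 (2 : R); move: (size _) => u; lia.
have mul (p q : {poly R}) : (size p <= 3)%N -> (size q <= (k.*2).+1)%N ->
    (size (p * q)%R <= (k.*2).+3)%N.
  move=> sp sq; apply: leq_trans (size_mul_leq _ _) _.
  by move: (size p) (size q) sp sq => u v; lia.
by split; apply: leq_trans (size_polyD _ _) _; rewrite geq_max ?size_polyN !mul.
Qed.

Lemma cos_sin_numE k (s : R) :
  ((1 + s ^+ 2) ^+ k * cos (2 * k%:R * atan s)%R = (cos_sin_num k).1.[s]) /\
  ((1 + s ^+ 2) ^+ k * sin (2 * k%:R * atan s)%R = (cos_sin_num k).2.[s]).
Proof.
elim: k => [|k].
  by rewrite mulr0n mulr0 mul0r cos_0 sin_0 !hornerE expr0.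
rewrite /=; case: (cos_sin_num k) => C T /= [eC eT].
have -> : 2 * k.+1%:R * atan s = 2 * k%:R * atan s + (atan s + atan s).
  by rewrite -natr1; ring.
rewrite !(cosD, sinD) !hornerE -eC -eT exprS sin_atan_cos.
have := cos2_atan s; set u := cos (atan s); set v := 1 + s ^+ 2.
set W := v ^+ k; set c := cos _; set d := sin _ => e.
have e1 : v * (u * u - s * u * (s * u)) = 1 - s ^+ 2.
  by transitivity ((1 - s ^+ 2) * (v * u ^+ 2)); [ring | rewrite e mulr1].
have e2 : v * (s * u * u + u * (s * u)) = 2 * s.
  by transitivity ((2 * s) * (v * u ^+ 2)); [ring | rewrite e mulr1].
split.
  by rewrite -e1 -e2; ring.
  by rewrite -e1 -e2; ring.
Qed.

(** Modulo [q1] one has X^2 = -1, so the recursion sends (C, T) to (2 C - 2 X T, 2 T + 2 X C); a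
    pair of the form (w, w X) is thus multiplied by 4. *)
Lemma cos_sin_num_mod k :
  (exists U, (cos_sin_num k.+1).1 = (2 ^+ (k.*2).+1)%:P + q1 * U) /\
  (exists U, (cos_sin_num k.+1).2 = (2 ^+ (k.*2).+1)%:P * 'X + q1 * U).
Proof.
elim: k => [|k].
  by split; [exists (-1) | exists 0]; rewrite /= /q1 expr1 !polyC_natr; ring.
rewrite (cos_sin_numS k.+1); case: (cos_sin_num k.+1) => C T /= [[U ->] [V ->]].
rewrite doubleS !(exprS _ (k.*2).+2) !(exprS _ (k.*2).+1) !polyCM !polyC_natr.
set w := (_ ^+ _)%:P.
split; [exists ((1 - 'X^2) * U - 2 * 'X * V - w * 3) |
        exists ((1 - 'X^2) * V + 2 * 'X * U - w * 'X)].
  by rewrite /q1; ring.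
by rewrite /q1; ring.
Qed.

(* Trigonometric polynomials of degree at most [M] in the angle [2 * atan s]. *)
Definition circle_fun (M : nat) (h : R -> R) : Prop :=
  exists2 H : {poly R}, (size H <= (M.*2).+1)%N &
    forall s, (1 + s ^+ 2) ^+ M * h s = H.[s].

Lemma circle_fun_ext M (h k : R -> R) :
  (forall s, h s = k s) -> circle_fun M h -> circle_fun M k.
Proof. by move=> hk [H sH eH]; exists H => // s; rewrite -hk. Qed.

Lemma circle_fun0 M : circle_fun M (fun _ => 0).
Proof. by exists 0; rewrite ?size_poly0 // => s; rewrite mulr0 horner0. Qed.

Lemma circle_funD M (h k : R -> R) :
  circle_fun M h -> circle_fun M k -> circle_fun M (fun s => h s + k s).
Proof.
move=> [H sH eH] [K sK eK]; exists (H + K).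
  by rewrite (leq_trans (size_polyD _ _)) // geq_max sH.
by move=> s; rewrite mulrDr eH eK hornerD.
Qed.

Lemma circle_funZ M c (h : R -> R) :
  circle_fun M h -> circle_fun M (fun s => c * h s).
Proof.
move=> [H sH eH]; exists (c *: H); first exact: leq_trans (size_scale_leq _ _) sH.
by move=> s; rewrite mulrCA eH hornerZ.
Qed.

Lemma circle_fun_leq M M' (h : R -> R) :
  (M <= M')%N -> circle_fun M h -> circle_fun M' h.
Proof.
move=> le [H sH eH]; exists (q1 ^+ (M' - M) * H).
  apply: leq_trans (size_mul_leq _ _) _; rewrite size_q1X /=.
  by move: (size H) sH => u; rewrite -!muln2; lia.
by move=> s; rewrite hornerM -eH horner_exp q1E mulrA -exprD subnK.
Qed.

Lemma circle_fun_cos k : circle_fun k (fun s => cos (2 * k%:R * atan s)%R).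
Proof.
exists (cos_sin_num k).1; first by have [] := size_cos_sin_num k.
by move=> s; have [] := cos_sin_numE k s.
Qed.

Lemma circle_fun_sin k : circle_fun k (fun s => sin (2 * k%:R * atan s)%R).
Proof.
exists (cos_sin_num k).2; first by have [] := size_cos_sin_num k.
by move=> s; have [] := cos_sin_numE k s.
Qed.

Lemma circle_fun_regular M (h : R -> R) : circle_fun M h -> regular_fun h.
Proof.
move=> [H _ eH]; exists H, (q1 ^+ M); split=> s.
  by rewrite horner_exp expf_neq0 // q1_neq0.
by rewrite horner_exp q1E eH.
Qed.

(** The combination (a - b X) (a + b X) + b^2 (1 + X^2) is the nonzero constant a^2 + b^2. *)
Lemma coprimep_linear_q1 (a b : R) : a != 0 \/ b != 0 ->
  coprimep (a%:P + b%:P * 'X) q1.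
Proof.
move=> ab.
have n0 : a ^+ 2 + b ^+ 2 != 0.
  by rewrite paddr_eq0 ?sqr_ge0 // !sqrf_eq0 negb_and; case: ab => ->; rewrite ?orbT.
apply/coprimepP => d /dvdpP[u eu] /dvdpP[v ev].
have : d %| (a ^+ 2 + b ^+ 2)%:P.
  have -> : (a ^+ 2 + b ^+ 2)%:P =
      (a%:P - b%:P * 'X) * (a%:P + b%:P * 'X) + b%:P ^+ 2 * q1.
    by rewrite /q1 !(polyCD, polyC_exp); ring.
  by rewrite eu ev dvdp_add // !dvdp_mull.
by move=> dv; apply: dvdp_eqp1 dv _; rewrite polyC_eqp1.
Qed.

(** Over the common denominator the lower-order part [h] acquires a factor [q1], so modulo [q1] the
    numerator is a nonzero constant times a + b X. This provides the coprimality of [A] and [D]. *)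
Lemma circle_fun_lead M (a b : R) (h : R -> R) : a != 0 \/ b != 0 ->
  circle_fun M h ->
  exists H : {poly R}, [/\ (size H <= (M.+1.*2).+1)%N, coprimep H q1 &
    forall s, (1 + s ^+ 2) ^+ M.+1 *
      (a * cos (2 * M.+1%:R * atan s)%R + b * sin (2 * M.+1%:R * atan s)%R + h s)
      = H.[s]].
Proof.
move=> ab [K sK eK].
exists (a *: (cos_sin_num M.+1).1 + b *: (cos_sin_num M.+1).2 + q1 * K); split.
- have [s1 s2] := size_cos_sin_num M.+1.
  apply: leq_trans (size_polyD _ _) _; rewrite geq_max; apply/andP; split.
    apply: leq_trans (size_polyD _ _) _; rewrite geq_max; apply/andP; split.
      exact: leq_trans (size_scale_leq _ _) s1.
    exact: leq_trans (size_scale_leq _ _) s2.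
  apply: leq_trans (size_mul_leq _ _) _; rewrite size_q1.
  by move: (size K) sK => u; rewrite -!muln2; lia.
- have [[U ->] [V ->]] := cos_sin_num_mod M.
  set w := 2 ^+ _.
  have w0 : w != 0 by rewrite expf_neq0 // pnatr_eq0.
  have -> : a *: (w%:P + q1 * U) + b *: (w%:P * 'X + q1 * V) + q1 * K =
      ((a * w)%:P + (b * w)%:P * 'X) + (a%:P * U + b%:P * V + K) * q1.
    by rewrite -!mul_polyC !polyCM; ring.
  rewrite coprimep_sym addrC coprimep_addl_mul coprimep_sym.
  by apply: coprimep_linear_q1; case: ab => ne0; [left|right]; rewrite mulf_neq0.
- move=> s; have [eC eS] := cos_sin_numE M.+1 s.
  rewrite !hornerD !hornerZ -eC -eS hornerM -eK q1E exprS; ring.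
Qed.

Lemma trig_polyE a b N t : trig_poly a b N t =
  a 0%N + \sum_(1 <= k < N.+1) (a k * cos (k%:R * t)%R + b k * sin (k%:R * t)%R).
Proof. by congr (_ + _); apply: eq_bigr => k _; rewrite -INRE. Qed.

Lemma trig_polyS a b N t : trig_poly a b N.+1 t =
  trig_poly a b N t + (a N.+1 * cos (N.+1%:R * t)%R + b N.+1 * sin (N.+1%:R * t)%R).
Proof. by rewrite !trig_polyE big_nat_recr //= addrA. Qed.

Lemma circle_fun_trig_poly a b N :
  circle_fun N (fun s => trig_poly a b N (2 * atan s)%R).
Proof.
elim: N => [|N IH].
  exists (a 0%N)%:P; first exact: size_polyC_leq1.
  by move=> s; rewrite trig_polyE big_geq // mul1r addr0 hornerC.
have c1 := circle_funZ (a N.+1) (circle_fun_cos N.+1).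
have c2 := circle_funZ (b N.+1) (circle_fun_sin N.+1).
apply: circle_fun_ext (circle_funD (circle_fun_leq (leqnSn N) IH) (circle_funD c1 c2)).
by move=> s; rewrite trig_polyS !(mulrCA _ 2) !mulrA.
Qed.

(** If a top coefficient is nonzero, the numerator is prime to [q1] and so is not 0; otherwise the
    top frequency is dropped. *)
Lemma trig_poly_neq0 (a b : nat -> R) N k :
  (k <= N)%N -> a k != 0 \/ (0 < k)%N /\ b k != 0 ->
  ~ (forall s, trig_poly a b N (2 * atan s)%R = 0).
Proof.
elim: N => [|N IH] in k *.
  rewrite leqn0 => /eqP -> [a0 h0|[]//].
  by have := h0 0; rewrite trig_polyE big_geq // addr0 => e; move: a0; rewrite e eqxx.
move=> kN abk; have [ab|] := boolP ((a N.+1 != 0) || (b N.+1 != 0)).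
  have [H [_ cop eH] h0] := circle_fun_lead (orP ab) (circle_fun_trig_poly a b N).
  have : H = 0.
    apply: poly_eq0_horner => s; rewrite -eH -[RHS](mulr0 ((1 + s ^+ 2) ^+ N.+1)) -(h0 s).
    by rewrite trig_polyS !(mulrCA _ 2) !(mulrA 2); ring.
  by move=> H0; move: cop; rewrite H0 coprime0p -size_poly_eq1 size_q1.
rewrite negb_or !negbK => /andP[/eqP a0 /eqP b0] h0.
case: (ltngtP k N.+1) kN => // [kN _|ek _]; last first.
  by move: abk; rewrite ek a0 b0 eqxx; case=> [//|[]].
refine (IH k kN abk _) => s.
by have := h0 s; rewrite trig_polyS a0 b0 !mul0r !addr0.
Qed.

(** * The curve with a given support function *)

(** Fourier coefficients of p': differentiation exchanges the two families. *)
Definition dcos_coef (b : nat -> R) (k : nat) : R := (k%:R * b k)%R.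
Definition dsin_coef (a : nat -> R) (k : nat) : R := (- (k%:R * a k))%R.

Lemma is_derive_trig_poly (a b : nat -> R) N (t : R) :
  is_derive (trig_poly a b N) t (trig_poly (dcos_coef b) (dsin_coef a) N t).
Proof.
elim: N => [|N IH].
  apply: (@is_derive_ext _ _ (fun _ => a 0%N)).
    by move=> u; rewrite trig_polyE big_geq // addr0.
  by rewrite trig_polyE big_geq // addr0 /dcos_coef mulr0n mul0r; apply: is_derive_const.
apply: (@is_derive_ext _ _ (fun u => plus (trig_poly a b N u)
  (a N.+1 * cos (N.+1%:R * u)%R + b N.+1 * sin (N.+1%:R * u)%R))).
  by move=> u; rewrite trig_polyS.
rewrite trig_polyS; apply: is_derive_plus => //.
have -> : (fun u : R => a N.+1 * cos (N.+1%:R * u)%R + b N.+1 * sin (N.+1%:R * u)%R)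
  = (fun u : R => Rplus (Rmult (a N.+1) (cos (Rmult N.+1%:R u)))
                        (Rmult (b N.+1) (sin (Rmult N.+1%:R u)))) by [].
auto_derive => //; rewrite !RealsE /dcos_coef /dsin_coef; ring.
Qed.

(** The curve is the envelope of the lines x cos t + y sin t = p(t), that is, p is its support
    function. *)
Definition support_x (a b : nat -> R) N (t : R) : R :=
  (trig_poly a b N t * cos t - trig_poly (dcos_coef b) (dsin_coef a) N t * sin t)%R.
Definition support_y (a b : nat -> R) N (t : R) : R :=
  (trig_poly a b N t * sin t + trig_poly (dcos_coef b) (dsin_coef a) N t * cos t)%R.

Lemma trig_curve_support a b N (t : R) : - PI <= t <= PI ->
  trig_curve a b N (support_x a b N t, support_y a b N t).
Proof.
by move=> t_pi; exists t; rewrite (is_derive_unique _ _ _ (is_derive_trig_poly a b N t)).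
Qed.

(** Frequency N + 1 of p contributes frequencies N and N + 2 to the point. The factor N / 2 vanishes
    for N = 0: frequency 1 only translates the curve. *)
Lemma support_xS a b N (t : R) :
  support_x a b N.+1 t = support_x a b N t +
    (a N.+1 * (- (N%:R / 2) * cos (N.+2%:R * t)%R + N.+2%:R / 2 * cos (N%:R * t)%R) +
     b N.+1 * (- (N%:R / 2) * sin (N.+2%:R * t)%R + N.+2%:R / 2 * sin (N%:R * t)%R)).
Proof.
rewrite /support_x !trig_polyS /dcos_coef /dsin_coef.
have -> : N.+2%:R * t = N.+1%:R * t + t by rewrite -[N.+2%:R]natr1; ring.
have -> : N%:R * t = N.+1%:R * t + - t by rewrite -[N.+1%:R]natr1; ring.
rewrite !(cosD, sinD, cosN, sinN) -[N.+2%:R]natr1 -[N.+1%:R]natr1.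
by field.
Qed.

Lemma support_yS a b N (t : R) :
  support_y a b N.+1 t = support_y a b N t +
    (a N.+1 * (- (N%:R / 2) * sin (N.+2%:R * t)%R - N.+2%:R / 2 * sin (N%:R * t)%R) +
     b N.+1 * (N%:R / 2 * cos (N.+2%:R * t)%R + N.+2%:R / 2 * cos (N%:R * t)%R)).
Proof.
rewrite /support_y !trig_polyS /dcos_coef /dsin_coef.
have -> : N.+2%:R * t = N.+1%:R * t + t by rewrite -[N.+2%:R]natr1; ring.
have -> : N%:R * t = N.+1%:R * t + - t by rewrite -[N.+1%:R]natr1; ring.
rewrite !(cosD, sinD, cosN, sinN) -[N.+2%:R]natr1 -[N.+1%:R]natr1.
by field.
Qed.

Lemma circle_fun_cos_mul m j M : ~~ odd (m * j) -> (m * j <= M.*2)%N ->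
  circle_fun M (fun s => cos (j%:R * (m%:R * atan s))%R).
Proof.
move=> ev le; have e : (m * j = 2 * (m * j)./2)%N by rewrite mul2n even_halfK.
apply: (@circle_fun_leq (m * j)./2); first by rewrite -leq_double even_halfK.
apply: circle_fun_ext (circle_fun_cos _) => s; congr cos.
by rewrite -natrM -e natrM; ring.
Qed.

Lemma circle_fun_sin_mul m j M : ~~ odd (m * j) -> (m * j <= M.*2)%N ->
  circle_fun M (fun s => sin (j%:R * (m%:R * atan s))%R).
Proof.
move=> ev le; have e : (m * j = 2 * (m * j)./2)%N by rewrite mul2n even_halfK.
apply: (@circle_fun_leq (m * j)./2); first by rewrite -leq_double even_halfK.
apply: circle_fun_ext (circle_fun_sin _) => s; congr sin.
by rewrite -natrM -e natrM; ring.
Qed.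

(* Only the frequencies [k.+1] and [k.-1] enter the [k]-th summand, hence the
   parity condition on [m * k.+1]. *)
Lemma circle_fun_support (m M N : nat) (a b : nat -> R) :
  (forall k, (k <= N)%N ->
    a k = 0 /\ (b k = 0 \/ k = 0%N) \/ ~~ odd (m * k.+1) /\ (m * k.+1 <= M.*2)%N) ->
  circle_fun M (fun s => support_x a b N (m%:R * atan s)%R) /\
  circle_fun M (fun s => support_y a b N (m%:R * atan s)%R).
Proof.
elim: N => [|N IH] hk.
  have e0 t : trig_poly a b 0 t = a 0%N /\ trig_poly (dcos_coef b) (dsin_coef a) 0 t = 0.
    by rewrite !trig_polyE !big_geq // /dcos_coef mulr0n mul0r !addr0.
  have [[a0 _]|[ev le]] := hk 0%N isT.
    split; apply: circle_fun_ext (circle_fun0 M) => s; rewrite /support_x /support_y.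
      by have [-> ->] := e0 (m%:R * atan s); rewrite a0 !mul0r subr0.
    by have [-> ->] := e0 (m%:R * atan s); rewrite a0 !mul0r addr0.
  split.
    apply: circle_fun_ext (circle_funZ (a 0%N) (circle_fun_cos_mul ev le)) => s.
    by rewrite /support_x; have [-> ->] := e0 (m%:R * atan s); rewrite mul0r subr0 mul1r.
  apply: circle_fun_ext (circle_funZ (a 0%N) (circle_fun_sin_mul ev le)) => s.
  by rewrite /support_y; have [-> ->] := e0 (m%:R * atan s); rewrite mul0r addr0 mul1r.
have [|IHx IHy] := IH; first by move=> k le; apply: hk; apply: ltnW.
have [[a0 [b0|//]]|[ev le]] := hk N.+1 (leqnn _).
  split; [apply: circle_fun_ext IHx|apply: circle_fun_ext IHy] => s.
    by rewrite support_xS a0 b0 !mul0r !addr0.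
  by rewrite support_yS a0 b0 !mul0r !addr0.
have ev' : ~~ odd (m * N) by move: ev; rewrite !oddM /= negbK.
have le' : (m * N <= M.*2)%N by apply: leq_trans le; rewrite leq_mul2l !leqW ?orbT.
have c1 := circle_fun_cos_mul ev le; have c2 := circle_fun_cos_mul ev' le'.
have s1 := circle_fun_sin_mul ev le; have s2 := circle_fun_sin_mul ev' le'.
have comb (u v : R) h k : circle_fun M h -> circle_fun M k ->
    circle_fun M (fun s => u * h s + v * k s).
  by move=> ch ck; apply: circle_funD; apply: circle_funZ.
split.
  apply: circle_fun_ext (circle_funD IHx (comb (a N.+1) (b N.+1) _ _
    (comb (- (N%:R / 2)) (N.+2%:R / 2) _ _ c1 c2)
    (comb (- (N%:R / 2)) (N.+2%:R / 2) _ _ s1 s2))) => s.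
  by rewrite support_xS.
apply: circle_fun_ext (circle_funD IHy (comb (a N.+1) (b N.+1) _ _
  (comb (- (N%:R / 2)) (- (N.+2%:R / 2)) _ _ s1 s2)
  (comb (N%:R / 2) (N.+2%:R / 2) _ _ c1 c2))) => s.
by rewrite support_yS; ring.
Qed.

(** Here t = m atan s: m = 2 gives s = tan (t / 2), and m = 1, for odd frequencies only, gives s =
    tan t. Since N >= 2, frequency N + 1 really occurs in x, and [circle_fun_lead] makes [A] prime
    to [q1]. *)
Lemma support_param (m N : nat) (a b : nat -> R) :
  (0 < m)%N -> (1 < N)%N -> a N != 0 \/ b N != 0 -> ~~ odd (m * N.+1) ->
  (forall k, (k <= N)%N -> odd (m * k.+1) -> a k = 0 /\ (b k = 0 \/ k = 0%N)) ->
  exists A B : {poly R},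
    [/\ (size A <= (m * N.+1).+1)%N, (size B <= (m * N.+1).+1)%N, coprimep A q1,
        forall s, A.[s] / (q1 ^+ (m * N.+1)./2).[s] = support_x a b N (m%:R * atan s)%R &
        forall s, B.[s] / (q1 ^+ (m * N.+1)./2).[s] = support_y a b N (m%:R * atan s)%R].
Proof.
move=> m0 N1 abN evN hodd; set M := (m * N.+1)./2.
have eM : M.*2 = (m * N.+1)%N by rewrite even_halfK.
have M0 : (0 < M)%N by rewrite -double_gt0 eM muln_gt0 m0.
have eMp : M = M.-1.+1 by rewrite prednK.
have e2M : (m * N.+1 = 2 * M)%N by rewrite mul2n eM.
case: N => [//|N] in N1 abN evN hodd M eM M0 eMp e2M *.
have [_ [B sB eB]] : circle_fun M (fun s => support_x a b N.+1 (m%:R * atan s)%R) /\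
    circle_fun M (fun s => support_y a b N.+1 (m%:R * atan s)%R).
  apply: circle_fun_support => k le; have [od|ev] := boolP (odd (m * k.+1)).
    by left; apply: hodd.
  by right; rewrite eM leq_mul2l ltnS le orbT.
have [xr _] : circle_fun M.-1 (fun s => support_x a b N (m%:R * atan s)%R) /\
    circle_fun M.-1 (fun s => support_y a b N (m%:R * atan s)%R).
  apply: circle_fun_support => k le; have [od|ev] := boolP (odd (m * k.+1)).
    by left; apply: hodd => //; apply: leqW.
  right; split=> //.
  have : (m * k.+1 < m * N.+2)%N by rewrite ltn_mul2l m0 ltnS.
  by rewrite -(even_halfK ev) e2M -!muln2 ; lia.
have N0 : N%:R / 2 != 0 :> R by rewrite mulf_neq0 ?invr_eq0 ?pnatr_eq0 // -lt0n.
have lemN : (m * N <= M.-1.*2)%N.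
  have : (m * N.+2 = m * N + 2 * m)%N by rewrite mulnC !mulSn mulnC; lia.
  by rewrite e2M -!muln2; lia.
have evN' : ~~ odd (m * N) by move: evN; rewrite !oddM /= negbK.
(* All of x except its top frequency. *)
have rest : circle_fun M.-1 (fun s => support_x a b N (m%:R * atan s)%R +
    (a N.+1 * (N.+2%:R / 2) * cos (N%:R * (m%:R * atan s))%R +
     b N.+1 * (N.+2%:R / 2) * sin (N%:R * (m%:R * atan s))%R)).
  apply: circle_funD => //.
  apply: circle_funD; apply: circle_funZ; first exact: circle_fun_cos_mul.
  exact: circle_fun_sin_mul.
have [|A [sA cop eA]] := @circle_fun_lead M.-1 (a N.+1 * - (N%:R / 2))%R
    (b N.+1 * - (N%:R / 2))%R _ _ rest.
  by case: abN => ne0; [left|right]; rewrite mulf_neq0 ?oppr_eq0.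
have D0 s : (1 + s ^+ 2) ^+ M != 0 :> R by rewrite -q1E expf_neq0 // q1_neq0.
exists A, B; split=> //.
- by rewrite -eM eMp.
- by rewrite -eM.
- move=> s; rewrite horner_exp q1E; apply: (mulIf (D0 s)); rewrite divfK //.
  rewrite -eA -eMp [RHS]mulrC; congr (_ * _).
  have -> : 2 * M%:R * atan s = N.+2%:R * (m%:R * atan s).
    by rewrite -natrM -e2M natrM; ring.
  by rewrite support_xS; ring.
- move=> s; rewrite horner_exp q1E; apply: (mulIf (D0 s)); rewrite divfK //.
  by rewrite -eB mulrC.
Qed.

(** * The gradient along the curve, and the case of odd frequencies *)

Lemma is_derive_eval2 (g : poly2) (x y : R -> R) (t dx dy : R) :
  is_derive x t dx -> is_derive y t dy ->
  is_derive (fun u => eval2 g (x u) (y u)) t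
    (eval2 g^`M(ord0) (x t) (y t) * dx + eval2 g^`M(ord_max) (x t) (y t) * dy)%R.
Proof.
have subUU (i : 'I_2) : (U_(i) - U_(i) = 0)%MM.
  by rewrite -{1}[U_(i)%MM]add0m addmK.
move=> hx hy; elim/mpoly2_ind: g => [c| | |g h IHg IHh|g h IHg IHh].
- rewrite !mderivC -[0]mpolyC0 !eval2C !mul0r addr0.
  apply: (@is_derive_ext _ _ (fun _ => c)); last exact: is_derive_const.
  by move=> u; rewrite eval2C.
- rewrite !mderivX !mnm1E eqxx /= scale1r scale0r subUU mpolyX0.
  rewrite -[0]mpolyC0 -[1]mpolyC1 !eval2C mul1r mul0r addr0.
  apply: is_derive_ext hx => u; by rewrite /eval2 mevalXU.
- rewrite !mderivX !mnm1E eqxx /= scale1r scale0r subUU mpolyX0.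
  rewrite -[0]mpolyC0 -[1]mpolyC1 !eval2C mul1r mul0r add0r.
  apply: is_derive_ext hy => u; by rewrite /eval2 mevalXU.
- apply: (is_derive_ext (fun u => plus (eval2 g (x u) (y u)) (eval2 h (x u) (y u)))).
    by move=> u; rewrite eval2D.
  have := is_derive_plus _ _ _ _ _ IHg IHh.
  by rewrite /plus /= !mderivD !eval2D => e; rewrite !mulrDl addrACA.
- apply: (is_derive_ext (fun u => mult (eval2 g (x u) (y u)) (eval2 h (x u) (y u)))).
    by move=> u; rewrite eval2M.
  have := is_derive_mult _ _ _ _ _ IHg IHh Rmult_comm.
  rewrite /plus /mult /= !mderivM !eval2D !eval2M !RealsE => e.
  by apply: eq_rect e _ _; ring.
Qed.

Lemma trig_polyD a b a' b' N t : trig_poly a b N t + trig_poly a' b' N t =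
  trig_poly (fun k => a k + a' k)%R (fun k => b k + b' k)%R N t.
Proof.
rewrite !trig_polyE addrACA -big_split; congr (_ + _).
by apply: eq_bigr => k _; rewrite /=; ring.
Qed.

(* The coefficients of [p + p''], the signed radius of curvature of the curve with
   support function [p]. *)
Definition radius_coef (a : nat -> R) (k : nat) : R := ((1 - k%:R ^+ 2) * a k)%R.

Lemma trig_poly_radius a b N t :
  trig_poly (radius_coef a) (radius_coef b) N t =
  trig_poly a b N t +
  trig_poly (dcos_coef (dsin_coef a)) (dsin_coef (dcos_coef b)) N t.
Proof.
rewrite trig_polyD !trig_polyE /radius_coef /dcos_coef /dsin_coef.
by congr (_ + _); [ring | apply: eq_bigr => k _; ring].
Qed.

(** The terms in p' cancel, which leaves a velocity orthogonal to (cos t, sin t). *)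
Lemma is_derive_support a b N (t : R) :
  let rho := trig_poly (radius_coef a) (radius_coef b) N t in
  is_derive (support_x a b N) t (- (rho * sin t))%R /\
  is_derive (support_y a b N) t (rho * cos t)%R.
Proof.
rewrite /= trig_poly_radius.
have dp := is_derive_trig_poly a b N t.
have dq := is_derive_trig_poly (dcos_coef b) (dsin_coef a) N t.
set p := trig_poly a b N in dp *; set q := trig_poly (dcos_coef b) _ N in dp dq *.
set r := trig_poly _ _ N t in dq *.
have ds := is_derive_sin t; have dc := is_derive_cos t.
split.
  have := is_derive_minus _ _ _ _ _ (is_derive_mult _ _ _ _ _ dp dc Rmult_comm)
    (is_derive_mult _ _ _ _ _ dq ds Rmult_comm).
  rewrite /minus /Hierarchy.opp /plus /mult /= !RealsE => e.
  by apply: eq_rect e _ _; ring.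
have := is_derive_plus _ _ _ _ _ (is_derive_mult _ _ _ _ _ dp ds Rmult_comm)
  (is_derive_mult _ _ _ _ _ dq dc Rmult_comm).
rewrite /plus /mult /= !RealsE => e.
by apply: eq_rect e _ _; ring.
Qed.

(** Such a derivative is a multiple of [f], yet has smaller degree if it is nonzero. *)
Lemma mderiv_vanishing_eq0 (A B D : {poly R}) (f : poly2) i :
  (forall s, D.[s] != 0) -> coprimep A D -> (1 < size D)%N ->
  irreducible2 f -> (forall s, on_param A B D f s = 0) ->
  (forall s, on_param A B D f^`M(i) s = 0) -> f^`M(i) = 0.
Proof.
move=> D0 cop sD irr fv gv; apply/eqP; apply: contraT => g0.
have [h eh] := irreducible2_dvd_vanishing D0 cop sD irr fv gv.
have h0 : h != 0 by apply: contraNneq g0 => h0; rewrite eh h0 mul0r.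
have f0 : f != 0 by apply: contraNneq g0 => f0; rewrite eh f0 mulr0.
have := mlead_supp g0; rewrite mcoeff_msupp mcoeff_mderiv => c0.
have : (mlead f^`M(i) + U_(i))%MM \in msupp f.
  by rewrite mcoeff_msupp; apply: contraNneq c0 => ->; rewrite mul0rn.
move/msize_mdeg_lt; rewrite -(mlead_deg f0) eh mleadM // !mdegD mdeg1.
by move: (mdeg _) (mdeg _) => u v; lia.
Qed.

(** Some variable occurs in the leading monomial of the nonconstant [f]; in characteristic 0 the
    derivative in that variable is nonzero. *)
Lemma irreducible2_gradient (f : poly2) : irreducible2 f ->
  f^`M(ord0) = 0 -> f^`M(ord_max) = 0 -> False.
Proof.
move=> [f1 _] fx fy.
have f0 : f != 0 by rewrite -msize_poly_eq0; move: f1; case: (msize f).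
have := mlead_supp f0; rewrite mcoeff_msupp.
have : (0 < mdeg (mlead f))%N by move: f1; rewrite -(mlead_deg f0).
set m := mlead f => dm; case/eqP.
have coef0 i : f^`M(i) = 0 -> (0 < m i)%N -> f@_m = 0.
  move=> fi mi; have := congr1 (mcoeff (m - U_(i))%MM) fi.
  rewrite mcoeff0 mcoeff_mderiv submK; last first.
    by apply/mnm_lepP => j; rewrite mnm1E; case: eqP => [<-|].
  by move/eqP; rewrite mulrn_eq0 /= => /eqP.
move: dm; rewrite mdeg2 addn_gt0 => /orP[]; exact: coef0.
Qed.

Definition curve_eval (a b : nat -> R) N (g : poly2) (t : R) : R :=
  eval2 g (support_x a b N t) (support_y a b N t).

Lemma atan_half_pi (s : R) : - (PI / 2) < atan s < PI / 2.
Proof.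
have [/RltP h1 /RltP h2] := atan_bound s.
by move: h1 h2; rewrite !RealsE mulNr => -> ->.
Qed.

Lemma double_atan_bound (s : R) : - PI < 2 * atan s < PI.
Proof. by have := atan_half_pi s; lra. Qed.

Lemma double_atan_onto (t : R) : - PI < t < PI -> exists s, t = 2 * atan s.
Proof.
move=> bt; exists (tan (t / 2)%R).
have /andP[/RltP h1 /RltP h2] : - (PI / 2) < t / 2 < PI / 2 by lra.
by rewrite atan_tan; [lra | split; rewrite !RealsE].
Qed.

Lemma curve_eval_vanishing a b N f (t : R) : - PI < t < PI ->
  (forall P, trig_curve a b N P -> eval2 f P.1 P.2 = 0) -> curve_eval a b N f t = 0.
Proof.
move=> /andP[h1 h2] fv; apply: (fv (_, _)); apply: trig_curve_support.
by rewrite !ltW.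
Qed.

Lemma regular_double_angle :
  regular_fun (fun s => cos (2 * atan s)%R) /\ regular_fun (fun s => sin (2 * atan s)%R).
Proof.
split; [have := circle_fun_cos 1 | have := circle_fun_sin 1] => /circle_fun_regular;
  by apply: regular_fun_ext => s; rewrite mulr1.
Qed.

Lemma regular_curve_eval a b N g :
  regular_fun (fun s => curve_eval a b N g (2 * atan s)%R).
Proof.
have [|cx cy] := @circle_fun_support 2 N.+1 N a b.
  by move=> k le; right; rewrite mul2n odd_double leq_double ltnS.
by apply: regular_eval2; [apply: circle_fun_regular cx|apply: circle_fun_regular cy].
Qed.

(* Differentiating [f (x, y) = 0] along the curve shows that the gradient of [f] is
   parallel to the normal direction [(cos t, sin t)]. *)
Lemma gradient_normal a b N f (t : R) : (1 < N)%N -> a N != 0 \/ b N != 0 ->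
  (forall P, trig_curve a b N P -> eval2 f P.1 P.2 = 0) -> - PI < t < PI ->
  curve_eval a b N f^`M(ord_max) t * cos t = curve_eval a b N f^`M(ord0) t * sin t.
Proof.
move=> N1 abN fv /double_atan_onto[s0 ->].
pose g s := curve_eval a b N f^`M(ord_max) (2 * atan s)%R * cos (2 * atan s)%R -
            curve_eval a b N f^`M(ord0) (2 * atan s)%R * sin (2 * atan s)%R.
suff g0 : forall s, g s = 0 by apply/eqP; rewrite -subr_eq0; apply/eqP; apply: g0.
pose rho s := trig_poly (radius_coef a) (radius_coef b) N (2 * atan s)%R.
have [rc rs] := regular_double_angle.
(* The derivative of f(x(t), y(t)) is [rho * g]. It vanishes on the open interval, and [rho] is not
   identically zero. *)
have [| | |rho0|//] := @regular_mul_eq0 rho g.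
- exact: circle_fun_regular (circle_fun_trig_poly _ _ _).
- have rf i := regular_curve_eval a b N f^`M(i).
  apply: regular_fun_ext (regularD (regularM (rf ord_max) rc)
    (regularM (regular_cst (-1)%R) (regularM (rf ord0) rs))) => s.
  by rewrite mulN1r.
- move=> s; have bs := double_atan_bound s; rewrite /g /rho.
  set t1 := 2 * atan s in bs *.
  have [dx dy] := is_derive_support a b N t1.
  have d1 := is_derive_eval2 f dx dy.
  have d0 : is_derive (fun u => eval2 f (support_x a b N u) (support_y a b N u)) t1 (0 : R).
    apply: (is_derive_ext_loc (fun _ : R => (0 : R))); last exact: is_derive_const.
    apply: (@locally_interval _ _ (Rbar.Finite (- PI)%R) (Rbar.Finite PI)) => /=.
    + by case/andP: bs => /RltP.
    + by case/andP: bs => _ /RltP.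
    + move=> u /= /RltP h1 /RltP h2; rewrite -/(curve_eval a b N f u).
      by rewrite curve_eval_vanishing // h1.
  have := is_derive_unique _ _ _ d1; rewrite (is_derive_unique _ _ _ d0) => e.
  by apply: etrans (esym e); rewrite /curve_eval; ring.
(* The top coefficients of [rho] are those of p times 1 - N^2, nonzero because N >= 2. *)
have N2 : 1 - N%:R ^+ 2 != 0 :> R.
  by rewrite -natrX subr_eq0 eq_sym pnatr_eq1 -(exp1n 2) eqn_exp2r // neq_ltn N1 orbT.
case: (@trig_poly_neq0 (radius_coef a) (radius_coef b) N N (leqnn N)) => //.
case: abN => ne0; [left | right; split; first exact: ltnW]; by rewrite mulf_neq0.
Qed.

(** Combines the two degree bounds. The condition on [Q] is relative to the gradient because the
    gradient is shown here not to vanish identically on the curve. *)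
Lemma degree_trig_curve (m N : nat) (a b : nat -> R) (f P Q : poly2) :
  (0 < m <= 2)%N -> (1 < N)%N -> a N != 0 \/ b N != 0 -> ~~ odd (m * N.+1) ->
  (forall k, (k <= N)%N -> odd (m * k.+1) -> a k = 0 /\ (b k = 0 \/ k = 0%N)) ->
  irreducible2 f -> (forall P, trig_curve a b N P -> eval2 f P.1 P.2 = 0) ->
  let ev g s := curve_eval a b N g (m%:R * atan s)%R in
  (~ ((forall s, ev f^`M(ord0) s = 0) /\ (forall s, ev f^`M(ord_max) s = 0)) ->
   ~ (forall s, ev Q s = 0)) ->
  (forall s, s * ev Q s = ev P s) ->
  total_degree f = (m * N.+1)%N.
Proof.
move=> /andP[m0 m2] N1 abN ev hodd irr fv evl Q0 PQ.
have [A [B [sA sB cop eA eB]]] := support_param m0 N1 abN ev hodd.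
set M := (m * N.+1)./2 in eA eB; pose D := q1 ^+ M.
have sD : size D = (m * N.+1).+1 by rewrite size_q1X even_halfK.
have sD1 : (1 < size D)%N by rewrite sD ltnS muln_gt0 m0.
have D0 s : D.[s] != 0 by rewrite horner_exp expf_neq0 // q1_neq0.
have copD : coprimep A D by rewrite coprimep_expr.
have opE g s : on_param A B D g s = evl g s by rewrite /on_param eA eB.
have fv' s : on_param A B D f s = 0.
  rewrite opE; apply: curve_eval_vanishing fv.
  have := double_atan_bound s; have := atan_half_pi s.
  case: m m0 m2 {evl Q0 PQ M D sD sD1 D0 copD opE eA eB sA sB ev hodd} => [|[|[|]]] // _ _.
  by lra.
have f0 : f != 0 by rewrite -msize_poly_eq0; case: irr => [+ _]; case: (msize f).
apply/eqP; rewrite eqn_leq (total_degree_le_param D0 copD sD1 sA sB) ?sD //=.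
apply: (@total_degree_ge_param A B D f P Q) => //.
- move=> z; apply: Q0; last by move=> s; rewrite -opE.
  case=> fx fy; apply: (irreducible2_gradient irr).
    by apply: (mderiv_vanishing_eq0 D0 copD sD1 irr fv') => s; rewrite opE.
  by apply: (mderiv_vanishing_eq0 D0 copD sD1 irr fv') => s; rewrite opE.
- by move=> s; rewrite !opE.
Qed.

(** The gradient is parallel to (cos t, sin t), so s = tan t is the quotient of the two partial
    derivatives of [f]. *)
Lemma degree_odd_trig_curve (N : nat) (a b : nat -> R) (f : poly2) :
  (1 < N)%N -> a N != 0 \/ b N != 0 ->
  (forall k, (k <= N)%N -> ~~ odd k -> a k = 0 /\ (b k = 0 \/ k = 0%N)) ->
  irreducible2 f -> (forall P, trig_curve a b N P -> eval2 f P.1 P.2 = 0) ->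
  total_degree f = N.+1.
Proof.
move=> N1 abN hev irr fv.
have oN : odd N.
  apply: contraT => /(hev N (leqnn N)) [aN [bN|N0]].
    by case: abN => /eqP.
  by rewrite N0 in N1.
have fyx s : s * curve_eval a b N f^`M(ord0) (1%:R * atan s)%R =
    curve_eval a b N f^`M(ord_max) (1%:R * atan s)%R.
  rewrite mul1r; have c0 := cos_atan_gt0 s.
  apply: (@mulIf _ (cos (atan s))); first by rewrite gt_eqF.
  rewrite (@gradient_normal a b N f) //; last first.
    by have := atan_half_pi s; lra.
  by rewrite sin_atan_cos; ring.
rewrite -[RHS]mul1n.
apply: (@degree_trig_curve 1 N a b f f^`M(ord_max) f^`M(ord0)) => //.
- by rewrite mul1n /= negbK.
- by move=> k le; rewrite mul1n /= => od; apply: hev.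
- by move=> n0 fx0; apply: n0; split=> // s; rewrite -fyx fx0 mulr0.
Qed.

(** * Functions polynomial on the curve, and the general case *)

Definition curve_poly (a b : nat -> R) N (h : R -> R) : Prop :=
  exists g : poly2, forall s, curve_eval a b N g (2 * atan s)%R = h s.

Lemma curve_poly_ext a b N (h k : R -> R) :
  (forall s, h s = k s) -> curve_poly a b N h -> curve_poly a b N k.
Proof. by move=> hk [g eg]; exists g => s; rewrite eg. Qed.

Lemma curve_poly_cst a b N c : curve_poly a b N (fun _ => c).
Proof. by exists c%:MP => s; apply: eval2C. Qed.

Lemma curve_polyD a b N (h k : R -> R) :
  curve_poly a b N h -> curve_poly a b N k -> curve_poly a b N (fun s => h s + k s).
Proof.
by move=> [g eg] [g' eg']; exists (g + g') => s; rewrite /curve_eval eval2D -eg -eg'.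
Qed.

Lemma curve_polyM a b N (h k : R -> R) :
  curve_poly a b N h -> curve_poly a b N k -> curve_poly a b N (fun s => h s * k s).
Proof.
by move=> [g eg] [g' eg']; exists (g * g') => s; rewrite /curve_eval eval2M -eg -eg'.
Qed.

Lemma curve_polyX a b N (h : R -> R) n :
  curve_poly a b N h -> curve_poly a b N (fun s => h s ^+ n).
Proof. by move=> [g eg]; exists (g ^+ n) => s; rewrite /curve_eval eval2X -eg. Qed.

(* The two hypotheses say that a vector [r * (cos t, sin t)] is polynomial on the
   curve; then so is [r ^+ 2], hence every [r ^+ L * cos (k t)] with [L - k] even. *)
Lemma curve_poly_trig a b N (r : R -> R) (c d : nat -> R) K L :
  curve_poly a b N (fun s => r s * cos (2 * atan s)%R) ->
  curve_poly a b N (fun s => r s * sin (2 * atan s)%R) ->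
  (K <= L)%N ->
  (forall k, (k <= K)%N -> odd (L - k) -> c k = 0 /\ d k = 0) ->
  curve_poly a b N (fun s => r s ^+ L * trig_poly c d K (2 * atan s)%R).
Proof.
move=> pc ps.
have pq : curve_poly a b N (fun s => r s ^+ 2).
  apply: curve_poly_ext (curve_polyD (curve_polyX 2 pc) (curve_polyX 2 ps)) => s.
  by rewrite !exprMn -mulrDr cos2Dsin2 mulr1.
(* Real and imaginary parts of the k-th power of r exp(i t), by the addition formulas. *)
have pcs k : curve_poly a b N (fun s => r s ^+ k * cos (k%:R * (2 * atan s))%R) /\
             curve_poly a b N (fun s => r s ^+ k * sin (k%:R * (2 * atan s))%R).
  elim: k => [|k [IHc IHs]].
    split; [apply: curve_poly_ext (curve_poly_cst a b N 1)|
            apply: curve_poly_ext (curve_poly_cst a b N 0)] => s.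
      by rewrite mulr0n mul0r cos_0 expr0 mul1r.
    by rewrite mulr0n mul0r sin_0 mulr0.
  have e s : k.+1%:R * (2 * atan s) = k%:R * (2 * atan s) + 2 * atan s.
    by rewrite -natr1; ring.
  split.
    apply: curve_poly_ext (curve_polyD (curve_polyM IHc pc)
      (curve_polyM (curve_poly_cst a b N (-1)%R) (curve_polyM IHs ps))) => s.
    by rewrite e cosD exprS; ring.
  apply: curve_poly_ext (curve_polyD (curve_polyM IHs pc) (curve_polyM IHc ps)) => s.
  by rewrite e sinD exprS; ring.
have term k (x y : R) : (k <= L)%N -> ~~ odd (L - k) -> curve_poly a b N (fun s =>
    r s ^+ L * (x * cos (k%:R * (2 * atan s))%R + y * sin (k%:R * (2 * atan s))%R)).
  move=> le ev; have [hc hs] := pcs k.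
  apply: curve_poly_ext (curve_polyM (curve_polyX (L - k)./2 pq)
    (curve_polyD (curve_polyM (curve_poly_cst a b N x) hc)
                 (curve_polyM (curve_poly_cst a b N y) hs))) => s.
  have -> : r s ^+ L = (r s ^+ 2) ^+ (L - k)./2 * r s ^+ k.
    by rewrite -exprM mul2n even_halfK // -exprD subnK.
  by ring.
elim: K => [|K IH] leK hodd.
  have [od|ev] := boolP (odd (L - 0)).
    have [c0 _] := hodd 0%N isT od.
    apply: curve_poly_ext (curve_poly_cst a b N 0) => s.
    by rewrite trig_polyE big_geq // c0 addr0 mulr0.
  apply: curve_poly_ext (term 0%N (c 0%N) 0 isT ev) => s.
  by rewrite mulr0n mul0r cos_0 mul0r addr0 trig_polyE big_geq // addr0 mulr1.
have {}IH := IH (ltnW leK) (fun k le => hodd k (leqW le)).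
have [od|ev] := boolP (odd (L - K.+1)).
  have [c0 d0] := hodd K.+1 (leqnn _) od.
  apply: curve_poly_ext IH => s.
  by rewrite trig_polyS c0 d0 !mul0r !addr0.
apply: curve_poly_ext (curve_polyD IH (term K.+1 (c K.+1) (d K.+1) leK ev)) => s.
by rewrite trig_polyS [RHS]mulrDr.
Qed.

Definition even_part (a : nat -> R) (k : nat) : R := (if odd k then 0 else a k)%R.
Definition odd_part (a : nat -> R) (k : nat) : R := (if odd k then a k else 0)%R.

Lemma trig_poly_even_odd a b N t : trig_poly a b N t =
  trig_poly (even_part a) (even_part b) N t + trig_poly (odd_part a) (odd_part b) N t.
Proof.
rewrite trig_polyD !trig_polyE /even_part /odd_part /= addr0; congr (_ + _).
by apply: eq_bigr => k _; case: (odd k); rewrite ?add0r ?addr0.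
Qed.

(** The parameter is tan (t / 2) = sin t / (1 + cos t). Multiplying numerator and denominator by
    r^(2N+1) p_even makes both polynomial in (x, y): they become [E * f^]M(ord_max)[and]Er + E *
    f^[M(ord0)]. *)
Lemma degree_general_trig_curve (N k : nat) (a b : nat -> R) (f : poly2) :
  (1 < N)%N -> a N != 0 \/ b N != 0 ->
  (k <= N)%N -> ~~ odd k -> a k != 0 \/ (0 < k)%N /\ b k != 0 ->
  irreducible2 f -> (forall P, trig_curve a b N P -> eval2 f P.1 P.2 = 0) ->
  total_degree f = (2 * N.+1)%N.
Proof.
move=> N1 abN kN ev abk irr fv.
pose fx s := curve_eval a b N f^`M(ord0) (2 * atan s)%R.
pose fy s := curve_eval a b N f^`M(ord_max) (2 * atan s)%R.
pose c s := cos (2 * atan s)%R; pose d s := sin (2 * atan s)%R.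
have cd s : c s ^+ 2 + d s ^+ 2 = 1 by apply: cos2Dsin2.
have par s : fy s * c s = fx s * d s by apply: gradient_normal => //; apply: double_atan_bound.
(* The component of the gradient along the unit normal; by [par] it determines the gradient. *)
pose r s := fx s * c s + fy s * d s.
have rc s : r s * c s = fx s.
  have -> : r s * c s = fx s * c s ^+ 2 + (fy s * c s) * d s by rewrite /r; ring.
  by rewrite par -[RHS]mulr1 -(cd s); ring.
have rd s : r s * d s = fy s.
  have -> : r s * d s = (fx s * d s) * c s + fy s * d s ^+ 2 by rewrite /r; ring.
  by rewrite -par -[RHS]mulr1 -(cd s); ring.
have pc : curve_poly a b N (fun s => r s * c s) by exists f^`M(ord0) => s; rewrite rc.
have pd : curve_poly a b N (fun s => r s * d s) by exists f^`M(ord_max) => s; rewrite rd.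
pose pe s := trig_poly (even_part a) (even_part b) N (2 * atan s)%R.
pose po s := trig_poly (odd_part a) (odd_part b) N (2 * atan s)%R.
have NL : (N <= N.*2)%N by rewrite -addnn leq_addr.
have [E eE] : curve_poly a b N (fun s => r s ^+ N.*2 * pe s).
  apply: curve_poly_trig => // j le; rewrite oddB ?(leq_trans le) // odd_double /=.
  by rewrite /even_part => ->.
have [O eO] : curve_poly a b N (fun s => r s ^+ (N.*2).+1 * po s).
  apply: curve_poly_trig => // [|j le]; first exact: leqW.
  rewrite oddB ?(leq_trans le) //; last exact: leqW.
  by rewrite /= odd_double /odd_part; case: (odd j).
have [q eq] : curve_poly a b N (fun s => r s ^+ N.*2).
  apply: curve_poly_ext (curve_polyX N
    (curve_polyD (curve_polyX 2 pc) (curve_polyX 2 pd))) => s.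
  by rewrite !exprMn -mulrDr cd mulr1 -exprM mul2n.
(* On the curve x f_x + y f_y = r p, so [q] times it is r^(2N+1) p; subtracting r^(2N+1) p_odd
   leaves r^(2N+1) p_even, a product of the parity that [curve_poly_trig] does not reach. *)
pose Er := q * ('X_ord0 * f^`M(ord0) + 'X_ord_max * f^`M(ord_max)) - O.
have eEr s : curve_eval a b N Er (2 * atan s)%R = r s ^+ (N.*2).+1 * pe s.
  rewrite /curve_eval /Er eval2B eval2M eval2D !eval2M.
  rewrite -!/(curve_eval a b N _ _) eq eO -/(fx s) -/(fy s) -rc -rd.
  have := trig_poly_even_odd a b N (2 * atan s)%R; rewrite -/(pe s) -/(po s) => ep.
  have -> : pe s = trig_poly a b N (2 * atan s)%R - po s by rewrite ep addrK.
  rewrite /curve_eval /eval2 !mevalXU /= /support_x /support_y -/(c s) -/(d s).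
  set p := trig_poly _ _ _ _; set p' := trig_poly _ _ _ _.
  have -> : (p * c s - p' * d s) * (r s * c s) + (p * d s + p' * c s) * (r s * d s) =
      p * r s * (c s ^+ 2 + d s ^+ 2) by ring.
  by rewrite cd exprS; ring.
apply: (@degree_trig_curve 2 N a b f (E * f^`M(ord_max)) (Er + E * f^`M(ord0))) => //.
- by rewrite mul2n odd_double.
- by move=> j _; rewrite mul2n odd_double.
- move=> grad0 Q0; have [rgc rgd] := regular_double_angle.
  have cpos s : 1 + c s != 0.
    rewrite /c (_ : 2 * atan s = atan s + atan s); last by ring.
    rewrite cosD sin_atan_cos gt_eqF //; have := cos_atan_gt0 s.
    have := cos2_atan s; set u := cos _ => e u0.
    have -> : 1 + (u * u - s * u * (s * u)) = 2 * u ^+ 2 + (1 - (1 + s ^+ 2) * u ^+ 2) by ring.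
    by rewrite e subrr addr0 mulr_gt0 // exprn_gt0.
  have rgr : regular_fun r.
    by apply: regularD; apply: regularM => //; apply: regular_curve_eval.
  have rgpe : regular_fun pe := circle_fun_regular (circle_fun_trig_poly _ _ _).
  have [| | |r0|pe0] := @regular_mul_eq0 (fun s => r s ^+ (N.*2).+1) pe => //.
  + exact: regularX.
  + move=> s; apply: (mulIf (cpos s)); rewrite mul0r -[RHS](Q0 s).
    rewrite /curve_eval eval2D eval2M -!/(curve_eval a b N _ _) eEr eE -/(fx s) -rc.
    by rewrite !exprS; ring.
  + have {}r0 s : r s = 0 by apply/eqP; move/eqP: (r0 s); rewrite expf_eq0.
    by apply: grad0; split=> s; rewrite -/(fx s) -/(fy s) -?rc -?rd r0 mul0r.
  + apply: (@trig_poly_neq0 (even_part a) (even_part b) N k) pe0 => //.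
    by rewrite /even_part (negPf ev).
- move=> s; rewrite /curve_eval eval2D !eval2M -!/(curve_eval a b N _ _).
  rewrite eEr eE -/(fx s) -/(fy s) -rc -rd.
  have half : s * (1 + c s) = d s.
    rewrite /c /d (_ : 2 * atan s = atan s + atan s); last by ring.
    rewrite cosD sinD sin_atan_cos; have := cos2_atan s; set u := cos _ => e.
    have -> : s * (1 + (u * u - s * u * (s * u))) =
      s * u * u + u * (s * u) + s * (1 - (1 + s ^+ 2) * u ^+ 2) by ring.
    by rewrite e subrr mulr0 addr0.
  by rewrite -half exprS; ring.
Qed.

Theorem theorem2p5 (N : nat) (a b : nat -> R) :
  (2 <= N)%N ->
  (a N <> 0%R \/ b N <> 0%R) ->
  forall f : {mpoly R[2]}, defining_poly (trig_curve a b N) f ->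
    ((exists k : nat, ((2 * k <= N)%N /\ a (2 * k)%N <> 0%R) \/
                      ((2 <= 2 * k <= N)%N /\ b (2 * k)%N <> 0%R)) ->
       total_degree f = (2 * N + 2)%N) /\
    ((forall k : nat, (2 * k <= N)%N -> a (2 * k)%N = 0%R /\ (b (2 * k)%N = 0%R \/ k = 0%N)) ->
       total_degree f = (N + 1)%N).
Proof.
move=> N1 abN f [irr zf].
(* The curve is contained in its Zariski closure. *)
have fv P : trig_curve a b N P -> eval2 f P.1 P.2 = 0.
  by move=> CP; apply: (proj2 (zf P)) => g; apply.
have {}abN : a N != 0 \/ b N != 0 by case: abN => /eqP; [left|right].
split=> [[k abk]|hev].
  have -> : (2 * N + 2 = 2 * N.+1)%N by lia.
  have ev : ~~ odd (2 * k) by rewrite mul2n odd_double.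
  case: abk => [[le /eqP ne0]|[/andP[k0 le] /eqP ne0]].
    by apply: (degree_general_trig_curve N1 abN le ev) => //; left.
  by apply: (degree_general_trig_curve N1 abN le ev) => //; right; rewrite (ltnW k0).
rewrite addn1; apply: degree_odd_trig_curve fv => // k le ev.
have ek : k = (2 * k./2)%N by rewrite mul2n even_halfK.
have [] := hev k./2; first by rewrite -ek.
rewrite -ek => -> [->|k0]; split=> //; first by left.
by right; rewrite ek k0.
Qed.
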